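(* Let $\Gamma$ be a connected finite simplicial graph and let $A(\Gamma)$ be the associated right-angled Artin group, equipped with the star length metric. Then $A(\Gamma)$ is quasi-isometric to exactly one of the following: (1) a single point; (2) the countable regular tree $T_\infty$.
   Context: $A(\Gamma)=\langle V(\Gamma)\mid [a,b]=1 \text{ for each } \{a,b\}\in E(\Gamma)\rangle$. The star $\mathrm{St}(v)$ of a vertex $v$ is $v$ together with all vertices adjacent to $v$. The star length $\|g\|_*$ of $g\in A(\Gamma)$ is the minimum $\ell$ such that $g$ is a product of $\ell$ elements of $\bigcup_{v\in V(\Gamma)}\langle \mathrm{St}(v)\rangle$ (with $\|1\|_*=0$); the star length metric is $d_*(g,h)=\|gh^{-1}\|_*$. $T_\infty$ denotes the simplicial tree in which every vertex has countably infinite valence, with edges of length one. *)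

(* Defs.v *)
From HB Require Import structures.
From mathcomp Require Import all_boot all_order all_algebra.
From mathcomp Require Import generic_quotient.
From mathcomp Require Import all_classical all_reals.
From mathcomp Require Import topology.

Set Implicit Arguments.
Unset Strict Implicit.
Unset Printing Implicit Defensive.

Import Order.TTheory GRing.Theory Num.Theory.

Local Open Scope quotient_scope.
Local Open Scope classical_set_scope.
Local Open Scope ring_scope.

Record sgraph (V : eqType) := SGraph {
  edge :> rel V;
  edge_sym : symmetric edge;
  edge_irr : irreflexive edge
}.

Definition gconnected (V : eqType) (G : sgraph V) : Prop :=
  forall x y : V, exists p : seq V, path G x p /\ last x p = y.

(* A cyclic sequence of two vertices only traverses an edge back and forth. *)
Definition acyclic (V : eqType) (G : sgraph V) : Prop :=
  forall c : seq V, ucycle G c -> (size c <= 2)%N.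

Definition is_tree (V : eqType) (G : sgraph V) : Prop :=
  [/\ inhabited V, gconnected G & acyclic G].

Section Raag.
Context (V : finType) (G : sgraph V).

(* The letter (v, false) stands for v and (v, true) for its inverse. *)
Definition word : Type := seq (V * bool).

(* Equality of words in the right-angled Artin group of G: the congruence on the
   free monoid on the letters generated by free cancellation and by the relators
   [a, b] = a^-1 b^-1 a b, for {a, b} an edge. *)
Inductive raag_eq : word -> word -> Prop :=
| raag_refl u : raag_eq u u
| raag_sym u w : raag_eq u w -> raag_eq w u
| raag_trans u w t : raag_eq u w -> raag_eq w t -> raag_eq u t
| raag_cat u u' w w' :
    raag_eq u u' -> raag_eq w w' -> raag_eq (u ++ w) (u' ++ w')
| raag_cancel v b : raag_eq [:: (v, b); (v, ~~ b)] [::]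
| raag_comm a b : G a b ->
    raag_eq [:: (a, true); (b, true); (a, false); (b, false)] [::].

Definition raag_eqb (u w : word) : bool := `[< raag_eq u w >].

Lemma raag_eqb_refl : reflexive raag_eqb.
Proof. by move=> u; apply/asboolP; constructor. Qed.

Lemma raag_eqb_sym : symmetric raag_eqb.
Proof. by move=> u w; apply/asbool_equiv_eq; split; apply: raag_sym. Qed.

Lemma raag_eqb_trans : transitive raag_eqb.
Proof.
by move=> u w t /asboolP uw /asboolP wt; apply/asboolP; apply: raag_trans wt.
Qed.

Canonical raag_equiv :=
  EquivRel raag_eqb raag_eqb_refl raag_eqb_sym raag_eqb_trans.

Definition raag : Type := {eq_quot raag_equiv}.

HB.instance Definition _ := Choice.on raag.

Definition raag_pi (u : word) : raag := \pi_{eq_quot raag_equiv} u.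
Definition raag_repr (x : raag) : word := repr (x : {eq_quot raag_equiv}).

Lemma raag_piP u w : raag_pi u = raag_pi w <-> raag_eq u w.
Proof.
split; first by move=> /eqmodP /asboolP.
by move=> uw; apply/eqmodP/asboolP.
Qed.

Lemma raag_reprK x : raag_pi (raag_repr x) = x.
Proof. exact: reprK. Qed.

Lemma raag_repr_eq u : raag_eq (raag_repr (raag_pi u)) u.
Proof. by apply/raag_piP; rewrite raag_reprK. Qed.

Definition word_inv (u : word) : word := rev [seq (l.1, ~~ l.2) | l <- u].

Lemma word_inv_cat u w : word_inv (u ++ w) = word_inv w ++ word_inv u.
Proof. by rewrite /word_inv map_cat rev_cat. Qed.

Lemma word_invK : involutive word_inv.
Proof.
move=> u; rewrite /word_inv map_rev revK -map_comp map_id_in // => -[v b] _ /=.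
by rewrite negbK.
Qed.

Lemma word_mulV u : raag_eq (u ++ word_inv u) [::].
Proof.
elim: u => [|[v b] u IH]; first exact: raag_refl.
have -> : ((v, b) :: u) ++ word_inv ((v, b) :: u)
    = [:: (v, b)] ++ ((u ++ word_inv u) ++ [:: (v, ~~ b)]).
  by rewrite -cat1s word_inv_cat -!catA.
apply: raag_trans (raag_cancel v b).
apply: (@raag_cat [:: (v, b)] [:: (v, b)] _ [:: (v, ~~ b)]).
  exact: raag_refl.
by apply: (@raag_cat _ [::]) => //; exact: raag_refl.
Qed.

Lemma word_inv_eq u w : raag_eq u w -> raag_eq (word_inv u) (word_inv w).
Proof.
move=> uw; have h1 : raag_eq (word_inv u) (word_inv u ++ (w ++ word_inv w)).
  rewrite -{1}[word_inv u]cats0; apply: raag_cat; first exact: raag_refl.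
  exact/raag_sym/word_mulV.
apply: raag_trans h1 _; rewrite catA -{2}[word_inv w]cat0s.
apply: raag_cat; last exact: raag_refl.
apply: raag_trans (_ : raag_eq (word_inv u ++ u) [::]).
  by apply: raag_cat; [exact: raag_refl | exact: raag_sym].
by have := word_mulV (word_inv u); rewrite word_invK.
Qed.

Definition raag_one : raag := raag_pi [::].
Definition raag_mul (x y : raag) : raag :=
  raag_pi (raag_repr x ++ raag_repr y).
Definition raag_inv (x : raag) : raag := raag_pi (word_inv (raag_repr x)).

Lemma raag_piM u w : raag_pi (u ++ w) = raag_mul (raag_pi u) (raag_pi w).
Proof. by apply/raag_piP/raag_cat; apply/raag_sym/raag_repr_eq. Qed.

Lemma raag_piV u : raag_pi (word_inv u) = raag_inv (raag_pi u).
Proof. by apply/raag_piP/word_inv_eq/raag_sym/raag_repr_eq. Qed.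

Lemma raag_mulA : associative raag_mul.
Proof.
move=> x y z; rewrite -(raag_reprK x) -(raag_reprK y) -(raag_reprK z).
by rewrite -!raag_piM catA.
Qed.

Lemma raag_mul1 : left_id raag_one raag_mul.
Proof. by move=> x; rewrite -(raag_reprK x) -raag_piM. Qed.

Lemma raag_mulr1 : right_id raag_one raag_mul.
Proof. by move=> x; rewrite -(raag_reprK x) -raag_piM cats0. Qed.

Lemma raag_mulgV : right_inverse raag_one raag_inv raag_mul.
Proof.
move=> x; rewrite -(raag_reprK x) -raag_piV -raag_piM.
exact/raag_piP/word_mulV.
Qed.

Lemma raag_mulVg : left_inverse raag_one raag_inv raag_mul.
Proof.
move=> x; rewrite -(raag_reprK x) -raag_piV -raag_piM -{2}(word_invK (raag_repr x)).
exact/raag_piP/word_mulV.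
Qed.

HB.instance Definition _ := isGroup.Build raag
  raag_mulA raag_mul1 raag_mulr1 raag_mulVg raag_mulgV.

Definition raag_gen (v : V) : raag := raag_pi [:: (v, false)].

End Raag.

Definition is_subgroup (gT : groupType) (H : set gT) : Prop :=
  H 1%g /\ (forall x y, H x -> H y -> H (x * y^-1)%g).

Definition gen_subgroup (gT : groupType) (S : set gT) : set gT :=
  smallest (@is_subgroup gT) S.

Lemma gen_subgroup_is (gT : groupType) (S : set gT) :
  is_subgroup (gen_subgroup S).
Proof.
split; first by move=> H [[]].
by move=> x y xS yS H HP; case: (HP) => -[H1 HD] _; exact: HD (xS H HP) (yS H HP).
Qed.

Section StarLength.
Context (V : finType) (G : sgraph V).
Local Notation A := (raag G).
Local Open Scope group_scope.

Definition star (v : V) : set V := [set w | w = v \/ G v w].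

Definition star_subgroup (v : V) : set A :=
  gen_subgroup [set raag_gen G w | w in star v].

Definition star_factorization (l : nat) (g : A) : Prop :=
  exists s : seq A,
    [/\ size s = l,
        (forall x, x \in s -> exists v, star_subgroup v x) &
        g = \prod_(x <- s) x].

Lemma star_factorization1 : star_factorization 0 1.
Proof. by exists [::]; split=> //; rewrite big_nil. Qed.

Lemma star_factorizationM k l g h :
  star_factorization k g -> star_factorization l h ->
  star_factorization (k + l) (g * h).
Proof.
move=> [s [<- sP ->]] [t [<- tP ->]]; exists (s ++ t).
rewrite size_cat big_cat; split=> // x.
by rewrite mem_cat => /orP[xs|xt]; [exact: sP | exact: tP].
Qed.

Lemma star_factorizationV k g :
  star_factorization k g -> star_factorization k g^-1.
Proof.
move=> [s [<- sP ->]]; exists (rev [seq x^-1 | x <- s]).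
rewrite size_rev size_map; split=> //.
- move=> x; rewrite mem_rev => /mapP[y /sP [v vy] ->]; exists v.
  have [h1 hD] := gen_subgroup_is [set raag_gen G w | w in star v].
  by rewrite -[y^-1]mul1g; apply: hD.
- elim: s {sP} => [|x s IH]; first by rewrite !big_nil invg1.
  by rewrite big_cons invgM IH /= rev_cons -cats1 big_cat big_seq1.
Qed.

Lemma star_factorization_ex (g : A) :
  exists l, `[< star_factorization l g >].
Proof.
suff [l gl] : exists l, star_factorization l g by exists l; apply/asboolP.
have gen1 v : star_factorization 1 (raag_gen G v).
  exists [:: raag_gen G v]; rewrite big_seq1; split=> // x.
  rewrite inE => /eqP ->; exists v => H [_ SH]; apply: SH.
  by exists v => //; left.
rewrite -(raag_reprK g); elim: (raag_repr g) => [|[v b] u [l IH]].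
  by exists 0%N; exact: star_factorization1.
exists (1 + l)%N; rewrite -cat1s raag_piM.
apply: star_factorizationM => //; case: b; last exact: gen1.
have -> : raag_pi G [:: (v, true)] = (raag_gen G v)^-1.
  exact: (raag_piV G [:: (v, false)]).
exact: star_factorizationV.
Qed.

Definition star_length (g : A) : nat := ex_minn (star_factorization_ex g).

Lemma star_lengthP g : star_factorization (star_length g) g.
Proof. by rewrite /star_length; case: ex_minnP => l /asboolP. Qed.

Lemma star_length_le l g : star_factorization l g -> (star_length g <= l)%N.
Proof.
by move=> gl; rewrite /star_length; case: ex_minnP => k _; apply; apply/asboolP.
Qed.

Lemma star_length1 : star_length 1 = 0%N.
Proof.
by apply/eqP; rewrite -leqn0; apply/star_length_le/star_factorization1.
Qed.

Lemma star_length_eq0 g : star_length g = 0%N -> g = 1.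
Proof.
move=> g0; have := star_lengthP g; rewrite g0 => -[s [/size0nil -> _ ->]].
by rewrite big_nil.
Qed.

Lemma star_lengthV g : star_length g^-1 = star_length g.
Proof.
apply/eqP; rewrite eqn_leq; apply/andP; split.
  exact/star_length_le/star_factorizationV/star_lengthP.
by rewrite -{1}[g]invgK; apply/star_length_le/star_factorizationV/star_lengthP.
Qed.

Lemma star_lengthM g h : (star_length (g * h)%g <= star_length g + star_length h)%N.
Proof. by apply/star_length_le/star_factorizationM; apply: star_lengthP. Qed.

End StarLength.

(* R only fixes the type in which the star length metric takes its values. *)
Definition star_space (R : realType) (V : finType) (G : sgraph V) : Type :=
  raag G.

Section StarMetric.
Context (R : realType) (V : finType) (G : sgraph V).

HB.instance Definition _ := Choice.on (star_space R G).

Definition star_dist (g h : star_space R G) : R :=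
  (star_length ((g : raag G) * (h : raag G)^-1)%g)%:R.

Lemma star_distxx g : star_dist g g = 0.
Proof. by rewrite /star_dist mulgV star_length1. Qed.

Lemma star_dist_eq0 g h : star_dist g h = 0 -> g = h.
Proof.
move=> /eqP; rewrite pnatr_eq0 => /eqP /star_length_eq0 gh.
by apply/(mulIg (h : raag G)^-1%g); rewrite gh mulgV.
Qed.

Lemma star_dist_sym g h : star_dist g h = star_dist h g.
Proof. by rewrite /star_dist -star_lengthV invgM invgK. Qed.

Lemma star_dist_triangle h g k :
  star_dist g k <= star_dist g h + star_dist h k.
Proof.
rewrite /star_dist -natrD ler_nat.
apply: leq_trans (star_lengthM _ _).
by rewrite mulgA mulgVK.
Qed.

HB.instance Definition _ := isMetric.Build R (star_space R G)
  star_distxx star_dist_eq0 star_dist_sym star_dist_triangle.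

End StarMetric.

Section Realization.
Context (R : realType) (V : eqType) (G : sgraph V).

(* Barycentric coordinates of the point (1 - t) a + t b. *)
Definition edge_pt (a b : V) (t : R) : V -> R :=
  fun v => (1 - t) * (v == a)%:R + t * (v == b)%:R.

Definition in_face (a b : V) (x : V -> R) : Prop :=
  exists2 t : R, 0 <= t <= 1 & x = edge_pt a b t.

Definition is_face (a b : V) : Prop := a = b \/ G a b.

Record realization := Realization {
  coord :> V -> R;
  coordP : exists a b, is_face a b /\ in_face a b coord
}.

(* pl_path x y l: some piecewise linear path of length l goes from x to y, each
   edge being isometric to [0, 1]. A step joins two points of a common closed edge
   [a, b] (or vertex, if a = b) along it, and has length |x a - y a|. The metric
   is the infimum of the lengths of these paths. *)
Inductive pl_path : realization -> realization -> R -> Prop :=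
| pl_path0 x : pl_path x x 0
| pl_pathS (x y z : realization) a b l :
    is_face a b -> in_face a b x -> in_face a b y ->
    pl_path y z l -> pl_path x z (`|x a - y a| + l).

Definition length_dist (x y : realization) : R := inf [set l | pl_path x y l].

End Realization.

Definition realization_space (R : realType) (V : eqType) (G : sgraph V)
  (Gconn : gconnected G) : Type := realization R G.

Section RealizationMetric.
Context (R : realType) (V : eqType) (G : sgraph V).
Implicit Types x y z : realization R G.

Lemma realization_eq x y : (x : V -> R) = y -> x = y.
Proof.
case: x y => [f fP] [g gP] /= fg; rewrite {}fg in fP *.
by congr Realization; exact: Prop_irrelevance.
Qed.

Lemma pl_path_ge x y l v : pl_path x y l -> `|x v - y v| <= l.
Proof.
elim=> {x y l} [x|x y z a b l ab [s s01 xE] [t t01 yE] _ IH].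
  by rewrite subrr normr0.
apply: le_trans (ler_distD (y v) _ _) _; apply: lerD => //.
have [-> //|va] := eqVneq v a.
rewrite xE yE /edge_pt (negPf va) eqxx !mulr0 !add0r !mulr1.
have [vb|_] := eqVneq v b; last by rewrite !mulr0 subrr normr0.
have /negPf -> : a != b by rewrite -vb eq_sym.
by rewrite !mulr0 !addr0 !mulr1 opprD opprK addrACA subrr add0r addrC distrC.
Qed.

Lemma pl_path_ge0 x y l : pl_path x y l -> 0 <= l.
Proof.
case: (coordP x) => a _ /(pl_path_ge a); exact: le_trans.
Qed.

Lemma pl_path_cat x y z k l :
  pl_path x y k -> pl_path y z l -> pl_path x z (k + l).
Proof.
move=> xy; elim: xy z l => {x y k} [x|x y z a b k ab xab yab _ IH] t l.
  by rewrite add0r.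
by move=> /IH yt; rewrite -addrA; exact: pl_pathS ab xab yab yt.
Qed.

Lemma pl_path_step x y a b : is_face G a b -> in_face a b x -> in_face a b y ->
  pl_path x y `|x a - y a|.
Proof.
by move=> ab xab yab; rewrite -[X in pl_path _ _ X]addr0;
  apply: (pl_pathS ab xab yab); exact: pl_path0.
Qed.

Lemma pl_path_rev x y l : pl_path x y l -> pl_path y x l.
Proof.
elim=> {x y l} [x|x y z a b l ab xab yab _ IH]; first exact: pl_path0.
rewrite addrC distrC; apply: pl_path_cat IH _; exact: pl_path_step yab xab.
Qed.

Lemma vertex_face (v : V) : exists a b, is_face G a b /\
  in_face a b (edge_pt v v (0 : R)).
Proof.
by exists v, v; split; [left | exists 0 => //; rewrite lexx ler01].
Qed.

Definition vertex_pt (v : V) : realization R G := Realization (vertex_face v).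

Lemma edge_ptxx (v : V) (t : R) : edge_pt v v t = vertex_pt v.
Proof.
by apply/funext => w; rewrite /= /edge_pt -!mulrDl subrK subr0 addr0.
Qed.

Lemma vertex_in_face_l (a b : V) : in_face a b (vertex_pt a).
Proof.
exists 0; first by rewrite lexx ler01.
by apply/funext => v; rewrite /= /edge_pt !mul0r.
Qed.

Lemma vertex_in_face_r (a b : V) : in_face a b (vertex_pt b).
Proof.
exists 1; first by rewrite ler01 lexx.
by apply/funext => v; rewrite /= /edge_pt subrr !mul0r subr0 mul1r add0r addr0.
Qed.

Lemma pl_path_vertex x : exists v l, pl_path x (vertex_pt v) l.
Proof.
case: (coordP x) => a [b [ab xab]]; exists a; eexists.
exact: pl_path_step ab xab (vertex_in_face_l a b).
Qed.

Lemma pl_path_vertices (u v : V) : gconnected G ->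
  exists l, pl_path (vertex_pt u) (vertex_pt v) l.
Proof.
move=> /(_ u v) [p [+ <-]]; elim: p u {v} => [|w p IH] u /=.
  by exists 0; exact: pl_path0.
case/andP=> uw /IH [l pl]; eexists.
exact: pl_pathS (or_intror uw) (vertex_in_face_l u w) (vertex_in_face_r u w) pl.
Qed.

Lemma pl_path_ex x y : gconnected G -> exists l, pl_path x y l.
Proof.
move=> Gc; have [u [k xu]] := pl_path_vertex x.
have [v [l /pl_path_rev vy]] := pl_path_vertex y.
have [m uv] := pl_path_vertices u v Gc.
by eexists; apply: pl_path_cat xu (pl_path_cat uv vy).
Qed.

Lemma length_dist_le x y l : pl_path x y l -> length_dist x y <= l.
Proof.
by move=> xy; apply: ge_inf => //; exists 0 => k; exact: pl_path_ge0.
Qed.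

Lemma length_dist_ge x y c : gconnected G ->
  (forall l, pl_path x y l -> c <= l) -> c <= length_dist x y.
Proof.
by move=> Gc cl; apply: lb_le_inf; [exact: pl_path_ex | exact: cl].
Qed.

Context (Gconn : gconnected G).
Local Notation T := (realization_space R Gconn).

HB.instance Definition _ := gen_eqMixin T.
HB.instance Definition _ := gen_choiceMixin T.

Definition realization_dist (x y : T) : R := length_dist x y.

Lemma realization_distxx x : realization_dist x x = 0.
Proof.
apply/eqP; rewrite eq_le length_dist_le /=; last exact: pl_path0.
by apply: length_dist_ge => // l; exact: pl_path_ge0.
Qed.

Lemma realization_dist_eq0 x y : realization_dist x y = 0 -> x = y.
Proof.
move=> xy0; apply: realization_eq; apply/funext => v.
apply/eqP; rewrite -subr_eq0 -normr_le0 -xy0.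
by apply: length_dist_ge => // l; exact: pl_path_ge.
Qed.

Lemma realization_dist_sym x y : realization_dist x y = realization_dist y x.
Proof.
by congr inf; apply/seteqP; split=> l; exact: pl_path_rev.
Qed.

Lemma realization_dist_triangle y x z :
  realization_dist x z <= realization_dist x y + realization_dist y z.
Proof.
rewrite -lerBlDl; apply: length_dist_ge => // l yz; rewrite lerBlDl -lerBlDr.
apply: length_dist_ge => // k xy; rewrite lerBlDr.
by apply: length_dist_le; exact: pl_path_cat xy yz.
Qed.

HB.instance Definition _ := isMetric.Build R T realization_distxx
  realization_dist_eq0 realization_dist_sym realization_dist_triangle.

End RealizationMetric.

(* A model of the simplicial tree all of whose vertices have countably infinite
   valence (see Tinf_tree and Tinf_valence): vertices are finite sequences of
   naturals; the neighbours of s are n :: s for all n and, if s is nonempty,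
   behead s. *)
Definition Tinf_edge : rel (seq nat) := fun s t =>
  ((t != [::]) && (behead t == s)) || ((s != [::]) && (behead s == t)).

Lemma Tinf_edge_sym : symmetric Tinf_edge.
Proof. by move=> s t; rewrite /Tinf_edge orbC. Qed.

Lemma Tinf_edge_irr : irreflexive Tinf_edge.
Proof.
move=> [|n s] //; rewrite /Tinf_edge /= orbb; apply/eqP => /(congr1 size) /=.
by move=> /n_Sn.
Qed.

Definition Tinf_graph : sgraph (seq nat) := SGraph Tinf_edge_sym Tinf_edge_irr.

Lemma Tinf_edge_cons n s : Tinf_edge (n :: s) s.
Proof. by rewrite /Tinf_edge /= eqxx orbT. Qed.

Lemma Tinf_connected : gconnected Tinf_graph.
Proof.
move=> s t; elim: s => [|n s [p [sp pt]]]; last first.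
  by exists (s :: p); rewrite /= Tinf_edge_cons.
elim: t => [|n t [p [sp pt]]]; first by exists [::].
exists (rcons p (n :: t)); rewrite last_rcons rcons_path sp pt /=.
by rewrite Tinf_edge_sym Tinf_edge_cons.
Qed.

Lemma Tinf_edge_up s t : Tinf_edge s t -> (size t <= size s)%N -> t = behead s.
Proof.
move=> /orP[/andP[]|/andP[_ /eqP ->] //].
by case: t => // n t _ /eqP /= ->; rewrite ltnn.
Qed.

Lemma Tinf_acyclic : acyclic Tinf_graph.
Proof.
move=> c /andP[cyc c_uniq]; rewrite leqNgt; apply/negP => c3.
have [x xc xmax] : exists2 x, x \in c & forall y, y \in c -> (size y <= size x)%N.
  have : c != [::] by case: c c3 {cyc c_uniq}.
  elim: c {c3 cyc c_uniq} => // x [|y c] IH _.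
    by exists x; rewrite ?inE // => z; rewrite inE => /eqP ->.
  have [//|w wc wmax] := IH; have [wx|/ltnW xw] := leqP (size w) (size x).
    exists x; first by rewrite inE eqxx.
    by move=> z; rewrite inE => /orP[/eqP -> //|/wmax /leq_trans]; apply.
  exists w; first by rewrite inE wc orbT.
  by move=> z; rewrite inE => /orP[/eqP -> //|]; exact: wmax.
have [i p cE] := rot_to xc.
have mem_c y : y \in x :: p -> y \in c by rewrite -cE mem_rot.
move: cyc c_uniq c3; rewrite -(rot_cycle i) -(rot_uniq i) -(size_rot i) cE.
case: p mem_c {cE} => [|y p] //; case/lastP: p => [|p z] // mem_c /=.
rewrite rcons_path last_rcons => /andP[xy /andP[_ zx]].
have -> : y = behead x.
  by apply: Tinf_edge_up xy _; apply/xmax/mem_c; rewrite !inE eqxx orbT.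
have -> : z = behead x.
  apply: Tinf_edge_up; first by rewrite Tinf_edge_sym.
  by apply/xmax/mem_c; rewrite !inE mem_rcons inE eqxx !orbT.
by rewrite mem_rcons inE eqxx /= andbF.
Qed.

Lemma Tinf_tree : is_tree Tinf_graph.
Proof.
split; [by constructor; exact: [::] | exact: Tinf_connected | exact: Tinf_acyclic].
Qed.

Lemma Tinf_valence (s : seq nat) :
  ([set t | Tinf_graph s t] #= [set: nat])%card.
Proof.
apply: eq_card_nat; first exact: countableP.
move=> /(finite_image (head 0%N)) fin; apply: infinite_nat.
apply: sub_finite_set fin => n _; exists (n :: s) => //=.
by rewrite Tinf_edge_sym; exact: Tinf_edge_cons.
Qed.

Definition Tinf (R : realType) : Type := realization_space R Tinf_connected.

HB.instance Definition _ (R : realType) := Metric.on (Tinf R).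

Definition point_space (R : realType) : Type := unit.

Section PointMetric.
Context (R : realType).

HB.instance Definition _ := Choice.on (point_space R).

Definition point_dist (x y : point_space R) : R := 0.

Lemma point_distxx x : point_dist x x = 0. Proof. by []. Qed.

Lemma point_dist_eq0 x y : point_dist x y = 0 -> x = y.
Proof. by case: x y => -[]. Qed.

Lemma point_dist_sym x y : point_dist x y = point_dist y x.
Proof. by []. Qed.

Lemma point_dist_triangle y x z :
  point_dist x z <= point_dist x y + point_dist y z.
Proof. by rewrite /point_dist addr0. Qed.

HB.instance Definition _ := isMetric.Build R (point_space R)
  point_distxx point_dist_eq0 point_dist_sym point_dist_triangle.

End PointMetric.

Definition quasi_isometry (R : realType) (X Y : metricType R) (f : X -> Y) :
    Prop :=
  exists L C : R, [/\ 1 <= L, 0 <= C,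
    forall x x' : X,
      L^-1 * mdist x x' - C <= mdist (f x) (f x') <= L * mdist x x' + C &
    forall y : Y, exists x : X, mdist (f x) y <= C].

Definition quasi_isometric (R : realType) (X Y : metricType R) : Prop :=
  exists f : X -> Y, quasi_isometry f.

(* Main.v *)
Require Import Defs.
From mathcomp Require Import all_boot all_order all_algebra.
From mathcomp Require Import finmap.
From mathcomp Require Import all_classical all_reals topology.
From mathcomp Require Import zify ring lra.

(** The dichotomy is whether the opposite graph (two distinct vertices are related
    when they do not span an edge) is connected with at least two vertices.

    If it is not, either there is at most one vertex or the graph is a join of two
    nonempty parts. Then the group is the product of at most two subgroups, each
    contained in the subgroup of one star, star lengths are at most 2
    (star_length_small, star_length_join), and a bounded space is quasi-isometric
    to a point.

    If it is, the star length metric is shown to be a coarse tree that branches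
    infinitely everywhere. The algebraic input is a signed count of crossings: the
    letters a of a word that are met inside a given coset of the subgroup of the
    star of a, counted with sign, depend only on the value of the word
    (crossings_inv). In a tight word, one without letters that cancel after
    commutations, the crossings of one class all have the same sign. Hence any
    other word with the same value has to visit each of the cosets so crossed
    (crossing). Two facts follow. First, the exchange condition (exchange), so that
    tight words have minimal length and star length is monotone along them. Second,
    the bottleneck property (bottleneck): since these cosets have diameter at most one
    for the star metric, every path from x to x u, with u tight, passes within 2 of every
    point on the way spelled by u.

    A space with this bottleneck property is a quasi-tree: the coarse components of
    the set of points at distance at least 4 n from the base point are the vertices
    of level n of a tree, and sending a point to its component is a quasi-isometry,
    because the points of lowest height in a component are within bounded distance of
    one another (level_diameter). To identify the tree, each component must have
    infinitely many components of the next level inside (branching). For this, above a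
    point x one takes the points x e^n v, where v is a word whose consecutive
    letters never commute: it is the only tight word for its value
    (chain_unique), and it has large star length once it has visited all the vertices
    several times (long_chain). Every path between two of these points comes back
    near x. A tree all of whose vertices have countably many children is the tree of
    finite sequences of naturals (coarse_tree).

    The two cases exclude each other, since boundedness is invariant under
    quasi-isometry and the regular tree is unbounded. *)

Set Implicit Arguments.
Unset Strict Implicit.
Unset Printing Implicit Defensive.

Import Order.TTheory GRing.Theory Num.Theory.
Local Open Scope nat_scope.

(** * Concatenations of sequences *)

Lemma cat_cons_cases (T : eqType) (p q p' q' : seq T) x y :
  x != y -> p ++ x :: q = p' ++ y :: q' ->
  (exists r, p' = p ++ x :: r /\ q = r ++ y :: q') \/
  (exists r, p = p' ++ y :: r /\ q' = r ++ x :: q).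
Proof.
move=> xy; elim: p p' => [|z p IH] [|z' p'] //=.
- by move=> [xy']; move: xy; rewrite xy' eqxx.
- by move=> [<- ->]; left; exists p'.
- by move=> [<- <-]; right; exists p.
- move=> [<- /IH[[r [-> ->]]|[r [-> ->]]]].
    by left; exists r.
  by right; exists r.
Qed.

Lemma cat_eq_cases (T : Type) (p q p' q' : seq T) : p ++ q = p' ++ q' ->
  (exists r, p' = p ++ r /\ q = r ++ q') \/
  (exists r, p = p' ++ r /\ q' = r ++ q).
Proof.
elim: p p' => [|x p IH] [|x' p'] /=.
- by move=> ->; left; exists [::].
- by move=> ->; left; exists (x' :: p').
- by move=> <-; right; exists (x :: p).
- move=> [<- /IH[[r [-> ->]]|[r [-> ->]]]]; first by left; exists r.
  by right; exists r.
Qed.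

(** * Words in a right-angled Artin group and hyperplane crossings *)

Section Words.
Context (V : finType) (G : sgraph V).
Local Notation A := (raag G).
Local Notation pi := (raag_pi G).
Implicit Types (u w p q r : word V) (g h : A) (a e : V) (b : bool).

Lemma raag_pi_cat u w : pi (u ++ w) = (pi u * pi w)%g.
Proof. exact: raag_piM. Qed.

Lemma raag_pi_nil : pi [::] = 1%g.
Proof. by []. Qed.

Lemma raag_pi_inv u : pi (word_inv u) = (pi u)^-1%g.
Proof. exact: raag_piV. Qed.

Lemma raag_pi_letterV a b : pi [:: (a, ~~ b)] = (pi [:: (a, b)])^-1%g.
Proof. exact: (raag_pi_inv [:: (a, b)]). Qed.

Lemma raag_pi_surj g : exists u, pi u = g.
Proof. by exists (raag_repr g); exact: raag_reprK. Qed.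

Definition in_star a : pred V := fun v => (v == a) || G a v.

Lemma in_star_sym a v : in_star a v = in_star v a.
Proof. by rewrite /in_star eq_sym edge_sym. Qed.

Lemma in_starxx a : in_star a a.
Proof. by rewrite /in_star eqxx. Qed.

Definition word_in (P : pred V) w : bool := all (fun l => P l.1) w.

Lemma letter_commute a b v c : G a v ->
  (pi [:: (a, b)] * pi [:: (v, c)] = pi [:: (v, c)] * pi [:: (a, b)])%g.
Proof.
move=> av.
have main : commute (pi [:: (a, false)]) (pi [:: (v, false)]).
  have /raag_piP h := raag_comm av; move: h.
  rewrite -[[:: _; _; _; _]]/([:: _] ++ [:: _] ++ [:: _] ++ [:: _]).
  rewrite !raag_pi_cat raag_pi_nil.
  rewrite (raag_pi_letterV a false) (raag_pi_letterV v false) /commute => h.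
  set x := pi [:: (a, false)] in h *; set y := pi [:: (v, false)] in h *.
  by have := congr1 (fun t => (y * x * t)%g) h; rewrite mulg1 !mulgA mulgK mulgV mul1g.
have V1 (x y : A) : commute x y -> commute x^-1%g y.
  by move=> xy; apply/commute_sym/commuteV/commute_sym.
suff : commute (pi [:: (a, b)]) (pi [:: (v, c)]) by [].
case: b; case: c; rewrite ?(raag_pi_letterV a false) ?(raag_pi_letterV v false) //.
- by apply/V1/commuteV.
- by apply/V1.
- by apply/commuteV.
Qed.

Lemma star_word_commute a b w : word_in (in_star a) w ->
  (pi [:: (a, b)] * pi w = pi w * pi [:: (a, b)])%g.
Proof.
elim: w => [|[v c] w IH]; first by rewrite raag_pi_nil mulg1 mul1g.
rewrite /word_in /= => /andP[/= va /IH IHw].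
rewrite -(cat1s (v, c) w) raag_pi_cat mulgA -[RHS]mulgA -IHw [RHS]mulgA.
congr (_ * _)%g.
case/orP: va => [/eqP ->|va]; last exact: letter_commute.
have [<-//|bc] := eqVneq b c.
have -> : c = ~~ b by move: bc; case: (b); case: (c).
by rewrite raag_pi_letterV mulgV mulVg.
Qed.

Definition star_elt a g : Prop := exists2 w, word_in (in_star a) w & pi w = g.

Lemma star_elt1 a : star_elt a 1%g.
Proof. by exists [::]. Qed.

Lemma star_eltM a g h : star_elt a g -> star_elt a h -> star_elt a (g * h)%g.
Proof.
move=> [u ua <-] [w wa <-]; exists (u ++ w); last exact: raag_pi_cat.
by rewrite /word_in all_cat; apply/andP.
Qed.

Lemma star_eltV a g : star_elt a g -> star_elt a g^-1%g.
Proof.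
move=> [u ua <-]; exists (word_inv u); last exact: raag_pi_inv.
by rewrite /word_in /word_inv all_rev all_map.
Qed.

Lemma star_eltMl a g h : star_elt a g -> star_elt a (g * h)%g <-> star_elt a h.
Proof.
move=> ga; split; last exact: star_eltM.
by move=> /(star_eltM (star_eltV ga)); rewrite mulKg.
Qed.

Lemma star_eltMr a g h : star_elt a h -> star_elt a (g * h)%g <-> star_elt a g.
Proof.
move=> ha; split; last by move=> ga; exact: star_eltM.
by move=> /star_eltM /(_ (star_eltV ha)); rewrite mulgK.
Qed.

Lemma star_elt_letter a b v : in_star a v -> star_elt a (pi [:: (v, b)]).
Proof. by move=> va; exists [:: (v, b)] => //; rewrite /word_in /= va. Qed.

(** Replaces the subgroup generated by a star, an intersection of subgroups, by
    the words whose letters lie in that star. *)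
Lemma star_subgroupE a g : star_subgroup a g <-> star_elt a g.
Proof.
split.
  move=> /(_ (star_elt a)); apply; split.
    by split; [exact: star_elt1 | move=> x y xa /star_eltV; exact: star_eltM].
  move=> _ [v va <-]; apply: star_elt_letter; rewrite /in_star.
  by case: va => [->|->]; rewrite ?eqxx ?orbT.
move=> [w wa <-] {g}.
have [H1 HD] := gen_subgroup_is [set raag_gen G v | v in star G a]%classic.
have HV (x : A) : star_subgroup a x -> star_subgroup a (x^-1)%g.
  by move=> ?; rewrite -[(_^-1)%g]mul1g; exact: HD.
elim: w wa => [//|[v b] w IH]; rewrite /word_in /= => /andP[/= va /IH wa].
rewrite -(cat1s (v, b) w) raag_pi_cat -[pi w]invgK; apply: HD; last exact: HV.
have gv : star_subgroup a (raag_gen G v : A).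
  move=> K [_ SK]; apply: SK; exists v => //.
  by case/orP: va => [/eqP ->|]; [left | right].
case: b; last exact: gv.
by rewrite (raag_pi_letterV v false); exact: HV.
Qed.

(** Killing the generators outside P sends each relator to a relator or to a
    trivial word. This is the retraction of the group onto the subgroup generated
    by P; it is what lets a membership in a star subgroup be read on letters. *)
Lemma filter_raag_eq (P : pred V) u w : raag_eq G u w ->
  raag_eq G [seq l <- u | P l.1] [seq l <- w | P l.1].
Proof.
elim=> {u w} [u|u w _ IH|u w t _ IH1 _ IH2|u u' w w' _ IH1 _ IH2|v b|a c ac].
- exact: raag_refl.
- exact: raag_sym.
- exact: raag_trans IH2.
- by rewrite !filter_cat; exact: raag_cat.
- by rewrite /=; case: (P v); [exact: raag_cancel | exact: raag_refl].
- rewrite /=; case: (P a); case: (P c).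
  + exact: raag_comm.
  + exact: (raag_cancel G a true).
  + exact: (raag_cancel G c true).
  + exact: raag_refl.
Qed.

Lemma star_elt_filter a w : star_elt a (pi w) ->
  pi [seq l <- w | in_star a l.1] = pi w.
Proof.
move=> [u ua uw]; have /raag_piP /(filter_raag_eq (in_star a)) /raag_piP := uw.
by rewrite (all_filterP ua) uw => ->.
Qed.

(** With h the inverse of g, this counts the letters (a, b) of w that start in the
    coset of g modulo the subgroup of the star of a. Geometrically, the edges
    labelled a of such a coset are dual to the hyperplanes of one parallelism
    class, called the class of the crossing below, and b is the direction in which
    the hyperplane is crossed. *)
Fixpoint crossings a b h w : nat :=
  if w is l :: w' then
    ((l == (a, b)) && `[< star_elt a h >]) + crossings a b (h * pi [:: l])%g w'
  else 0.

Lemma crossings_cat a b h u w :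
  crossings a b h (u ++ w) = crossings a b h u + crossings a b (h * pi u)%g w.
Proof.
elim: u h => [|l u IH] h /=; first by rewrite raag_pi_nil mulg1.
by rewrite IH addnA -mulgA -(raag_pi_cat [:: l]).
Qed.

Lemma crossings_gt0 a b h w : 0 < crossings a b h w <->
  exists p q, w = p ++ (a, b) :: q /\ star_elt a (h * pi p)%g.
Proof.
split.
  elim: w h => [//|l w IH] h /=.
  case: eqP => [->|_]; last first.
    rewrite add0n => /IH[p [q [-> pa]]]; exists (l :: p), q; split => //.
    by rewrite -cat1s raag_pi_cat mulgA.
  case: asboolP => [ha _|_].
    by exists [::], w; split => //; rewrite raag_pi_nil mulg1.
  rewrite add0n => /IH[p [q [-> pa]]]; exists ((a, b) :: p), q; split => //.
  by rewrite -cat1s raag_pi_cat mulgA.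
move=> [p [q [-> pa]]]; rewrite crossings_cat /= eqxx.
by case: asboolP => // _; rewrite addnC.
Qed.

(** The number of crossings counted with sign depends only on the group element:
    the two letters of a cancelling pair are met in the same coset, and so are the
    two letters a of a commutator with a neighbour of a. The difference of
    the two counts is the invariant; it is stated with sums because they are
    natural numbers. *)
Lemma crossings_inv a b u w : raag_eq G u w -> forall h,
  crossings a b h u + crossings a (~~ b) h w =
  crossings a b h w + crossings a (~~ b) h u.
Proof.
elim=> {u w} [u|u w _ IH|u w t _ IH1 _ IH2|u u' w w' uu' IH1 _ IH2|v c|v c vc] h.
- by [].
- by rewrite IH.
- by have := IH1 h; have := IH2 h; lia.
- rewrite !crossings_cat; have := IH1 h; have := IH2 (h * pi u)%g.
  by have /raag_piP -> := uu'; lia.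
- rewrite /= !xpair_eqE; have [->|_] := eqVneq v a => //=.
  have -> : `[< star_elt a (h * pi [:: (a, c)])%g >] = `[< star_elt a h >].
    by apply/asbool_equiv_eq/star_eltMr/star_elt_letter/in_starxx.
  by case: c; case: b; case: `[< _ >].
- rewrite /= !xpair_eqE.
  have [va|va] := eqVneq v a; have [ca|ca] := eqVneq c a => //=.
  + by move: vc; rewrite va ca edge_irr.
  + subst v; rewrite -(mulgA h).
    have -> : `[< star_elt a (h * (pi [:: (a, true)] * pi [:: (c, true)]))%g >] =
            `[< star_elt a h >].
      apply/asbool_equiv_eq/star_eltMr/star_eltM; apply: star_elt_letter.
        exact: in_starxx.
      by rewrite /in_star vc orbT.
    by case: b; case: `[< _ >].
  + subst c.
    have -> : `[< star_elt a (h * pi [:: (v, true)] * pi [:: (a, true)]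
                             * pi [:: (v, false)])%g >] =
            `[< star_elt a (h * pi [:: (v, true)])%g >].
      rewrite -(mulgA (h * _))%g.
      apply/asbool_equiv_eq/star_eltMr/star_eltM; apply: star_elt_letter.
        exact: in_starxx.
      by rewrite /in_star edge_sym vc orbT.
    by case: b; case: `[< _ >].
Qed.

(** No letter cancels against a later one after commuting with everything in
    between. This is the combinatorial criterion for a word to be of minimal
    length (minimal_tight, tight_minimal). *)
Definition tight w : Prop := forall p a b q r,
  w = p ++ (a, b) :: q ++ (a, ~~ b) :: r -> ~~ word_in (in_star a) q.

Definition minimal w : Prop := forall u, pi u = pi w -> size w <= size u.

Lemma tight_infix p w q : tight (p ++ w ++ q) -> tight w.
Proof.
move=> t p' a b q' r wE; apply: (t (p ++ p') a b q' (r ++ q)).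
by rewrite wE -!catA /= -!catA.
Qed.

Lemma cancel_pair p a b q r : word_in (in_star a) q ->
  pi (p ++ (a, b) :: q ++ (a, ~~ b) :: r) = pi (p ++ q ++ r).
Proof.
move=> qa; rewrite -(cat1s (a, b)) -(cat1s (a, ~~ b)) !raag_pi_cat; congr (_ * _)%g.
by rewrite !mulgA star_word_commute // raag_pi_letterV mulgK.
Qed.

Lemma minimal_tight w : minimal w -> tight w.
Proof.
move=> wmin p a b q r wE; apply/negP => qa.
have := wmin (p ++ q ++ r); rewrite wE cancel_pair // => /(_ erefl).
by rewrite !size_cat /= size_cat /=; lia.
Qed.

Lemma minimal_exists g : exists2 w, minimal w & pi w = g.
Proof.
have [u <-] := raag_pi_surj g.
elim: {u}(size u) {-2}u (leqnn (size u)) => [|n IH] u un.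
  by exists u => // w _; move: un; case: (size u).
have [umin|] := pselect (minimal u); first by exists u.
move=> /existsNP[w] /not_implyP[wu /negP]; rewrite -ltnNge => wlt.
by have [|v vmin vw] := IH w; [lia | exists v => //; rewrite vw].
Qed.

(** The retraction onto the star would otherwise shorten w. *)
Lemma minimal_star_word a w : minimal w -> star_elt a (pi w) ->
  word_in (in_star a) w.
Proof.
move=> wmin /star_elt_filter /wmin; rewrite size_filter => wle.
by rewrite /word_in all_count eqn_leq count_size.
Qed.

(** In a tight word, all the crossings of one class have the same sign: between
    two opposite crossings there is a tight word r whose value is in the star
    subgroup, hence whose letters are in the star, and the two letters cancel. So the
    signed count at the coset of p is positive, and every word with the same
    value must cross this class with the same sign.

    The minimality of shorter tight words is a hypothesis because this lemma is
    used in the induction that proves it. *)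
Lemma crossing_sub p a b q u :
  (forall r, size r < size (p ++ (a, b) :: q) -> tight r -> minimal r) ->
  tight (p ++ (a, b) :: q) -> pi u = pi (p ++ (a, b) :: q) ->
  exists u1 u2, u = u1 ++ (a, b) :: u2 /\ star_elt a ((pi p)^-1 * pi u1)%g.
Proof.
set w := p ++ _ => IH wt uw; set h := (pi p)^-1%g.
have pos : 0 < crossings a b h w.
  by apply/crossings_gt0; exists p, q; split => //; rewrite mulVg; exact: star_elt1.
have zero : crossings a (~~ b) h w = 0.
  apply/eqP; rewrite -leqn0 leqNgt; apply/negP => /crossings_gt0[p' [q' [wE pa]]].
  have ab : (a, b) != (a, ~~ b) by rewrite xpair_eqE eqxx; case: (b).
  (* r is the part between the two crossings, together with one of them *)
  have key r s t : w = s ++ r ++ t -> size r < size w -> star_elt a (pi r) ->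
      word_in (in_star a) r.
    move=> wE' rw ra; apply: minimal_star_word => //; apply: IH => //.
    by apply: (@tight_infix s r t); rewrite -wE'.
  have [[r [p'E qE]]|[r [pE q'E]]] := cat_cons_cases ab wE.
    have wE1 : w = p ++ (a, b) :: r ++ (a, ~~ b) :: q' by rewrite /w qE.
    apply: (negP (wt _ _ _ _ _ wE1)).
    apply: (key r (rcons p (a, b)) ((a, ~~ b) :: q')).
    - by rewrite /w qE cat_rcons.
    - by rewrite /w qE !size_cat /= size_cat; lia.
    move: pa; rewrite p'E raag_pi_cat mulKg -cat1s raag_pi_cat star_eltMl //.
    exact/star_elt_letter/in_starxx.
  have wE1 : w = p' ++ (a, ~~ b) :: r ++ (a, ~~ ~~ b) :: q.
    by rewrite negbK wE q'E.
  apply: (negP (wt _ _ _ _ _ wE1)).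
  apply: (key r (rcons p' (a, ~~ b)) ((a, b) :: q)).
  - by rewrite wE q'E cat_rcons.
  - by rewrite wE q'E !size_cat /= size_cat; lia.
  move: pa; rewrite /h pE -(cat1s (a, ~~ b)) !raag_pi_cat !invgM -mulgA mulVg mulg1.
  rewrite star_eltMr; last by apply/star_eltV/star_elt_letter/in_starxx.
  by move=> /star_eltV; rewrite invgK.
have /raag_piP /(crossings_inv a b) /(_ h) := uw; rewrite zero addn0 => cE.
by apply/crossings_gt0; lia.
Qed.

(** Exchange condition: the letter of u that crosses the class of the last letter
    of the tight word starts at w s instead of w, with s in the subgroup of the
    star of a. As s commutes with the letter, deleting it from u has the same effect
    as deleting the last letter of the tight word. *)
Lemma exchange_sub w a b u :
  (forall r, size r <= size w -> tight r -> minimal r) ->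
  tight (rcons w (a, b)) -> pi u = pi (rcons w (a, b)) ->
  exists u1 u2, [/\ u = u1 ++ (a, b) :: u2, pi (u1 ++ u2) = pi w &
                    star_elt a (pi u2)].
Proof.
rewrite -cats1 => IH wt uw.
have [|u1 [u2 [uE u1a]]] := crossing_sub _ wt uw.
  by move=> r; rewrite size_cat addn1 ltnS; exact: IH.
exists u1, u2; move: uw; rewrite uE -cat1s !raag_pi_cat.
set s := (_ * pi u1)%g in u1a; have -> : pi u1 = (pi w * s)%g by rewrite mulVKg.
have cs : (s * pi [:: (a, b)] = pi [:: (a, b)] * s)%g.
  by case: u1a => t ta <-; rewrite star_word_commute.
rewrite -mulgA => /mulgI; rewrite mulgA cs -mulgA -{2}[pi [:: (a, b)]]mulg1.
move=> /mulgI su2; split=> //; first by rewrite -mulgA su2 mulg1.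
have -> : pi u2 = s^-1%g by apply/(mulgI s); rewrite su2 mulgV.
exact: star_eltV.
Qed.

(** By the exchange condition, the last letter of w can be removed from w and from
    any competitor u at the same time. *)
Lemma tight_minimal w : tight w -> minimal w.
Proof.
elim: {w}(size w) {-2}w (leqnn (size w)) => [|n IH] w wn wt.
  by move=> u _; move: wn; rewrite leqn0 => /eqP ->.
case/lastP: w wn wt => [|w [a b]] wn wt; first by [].
move: wn; rewrite size_rcons ltnS => wn u uw.
have [|u1 [u2 [-> u12 _]]] := exchange_sub _ wt uw.
  by move=> r rw; apply: IH; exact: leq_trans rw wn.
have wt' : tight w by apply: (@tight_infix [::] w [:: (a, b)]); rewrite cats1.
have := IH w wn wt' _ u12.
by rewrite !size_cat /= size_rcons; lia.
Qed.

Lemma crossing p a b q u : tight (p ++ (a, b) :: q) ->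
  pi u = pi (p ++ (a, b) :: q) ->
  exists u1 u2, u = u1 ++ (a, b) :: u2 /\ star_elt a ((pi p)^-1 * pi u1)%g.
Proof. by apply: crossing_sub => r _; exact: tight_minimal. Qed.

Lemma exchange w a b u : tight (rcons w (a, b)) -> pi u = pi (rcons w (a, b)) ->
  exists u1 u2, [/\ u = u1 ++ (a, b) :: u2, pi (u1 ++ u2) = pi w &
                    star_elt a (pi u2)].
Proof. by apply: exchange_sub => r _; exact: tight_minimal. Qed.

End Words.

(** * Star length of words *)

Section StarLengthWords.
Context (V : finType) (G : sgraph V).
Local Notation A := (raag G).
Local Notation pi := (raag_pi G).
Local Notation sl := (@star_length V G).
Local Notation tight := (tight G).
Local Notation in_star := (in_star G).
Implicit Types (u w p q r : word V) (g h : A) (a e : V) (b : bool)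
  (ss : seq (word V)).

Definition star_word w : bool := [exists a, word_in (in_star a) w].

Lemma word_in_sub P u w : {subset u <= w} -> word_in P w -> @word_in V P u.
Proof. by move=> uw /allP wP; apply/allP => l /uw /wP. Qed.

Lemma star_word_sub u w : {subset u <= w} -> star_word w -> star_word u.
Proof.
by move=> uw /existsP[a wa]; apply/existsP; exists a; exact: word_in_sub wa.
Qed.

Lemma star_length_flatten ss : all star_word ss ->
  sl (pi (flatten ss)) <= size ss.
Proof.
move=> ssP; apply: star_length_le; exists [seq pi w | w <- ss]; split.
- by rewrite size_map.
- move=> x /mapP[w /(allP ssP) /existsP[a wa] ->]; exists a.
  by apply/star_subgroupE; exists w.
- elim: ss {ssP} => [|w ss IH]; first by rewrite big_nil.
  by rewrite /= big_cons raag_pi_cat IH.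
Qed.

Lemma star_length_blocks g : exists ss,
  [/\ all star_word ss, size ss = sl g & pi (flatten ss) = g].
Proof.
have [s [<- sP ->]] := star_lengthP g; elim: s sP => [|x s IH] sP.
  by exists [::]; rewrite big_nil.
have [|ss [ssP ssn ssE]] := IH.
  by move=> y ys; apply: sP; rewrite inE ys orbT.
have [a /star_subgroupE[w wa wx]] := sP x (mem_head x s).
exists (w :: ss); rewrite /= ssP ssn andbT raag_pi_cat ssE big_cons wx; split=> //.
by apply/existsP; exists a.
Qed.

Lemma remove_letter ss u1 l u2 : all star_word ss -> flatten ss = u1 ++ l :: u2 ->
  exists ss', [/\ all star_word ss', size ss' = size ss & flatten ss' = u1 ++ u2].
Proof.
elim: ss u1 => [|w ss IH] u1; first by case: u1.
move=> /= /andP[wP ssP] /esym/cat_eq_cases[[[|k r] [wE uE]]|[r [u1E ssE]]].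
- have [|ss' [? <- ss'E]] := IH [::] ssP; first by move: uE => /= <-.
  by exists (w :: ss'); rewrite /= wP ss'E wE cats0.
- exists ((u1 ++ r) :: ss); rewrite /= ssP andbT; split=> //.
    apply: star_word_sub wP => x; rewrite wE !mem_cat inE.
    by case: (x \in u1) => //= ->; rewrite orbT.
  by case: uE => _ ->; rewrite catA.
- have [ss' [? <- ss'E]] := IH _ ssP ssE.
  by exists (w :: ss'); rewrite /= wP ss'E u1E catA.
Qed.

(** Star length never decreases along a tight word: by the exchange
    condition the last letter can be deleted from one block of an optimal
    factorization, without changing the number of blocks. *)
Lemma star_length_rcons w l : tight (rcons w l) ->
  sl (pi w) <= sl (pi (rcons w l)).
Proof.
case: l => a b wt; have [ss [ssP <- ssE]] := star_length_blocks (pi (rcons w (a, b))).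
have [u1 [u2 [uE <- _]]] := exchange wt ssE.
have [ss' [ss'P <- <-]] := remove_letter ssP uE.
exact: star_length_flatten.
Qed.

Lemma tight_prefix u w : tight (u ++ w) -> tight u.
Proof. exact: (@tight_infix V G [::] u w). Qed.

Lemma tight_suffix u w : tight (u ++ w) -> tight w.
Proof. by rewrite -[w in u ++ w]cats0; exact: (@tight_infix V G u w [::]). Qed.

Lemma star_length_cat u w : tight (u ++ w) -> sl (pi u) <= sl (pi (u ++ w)).
Proof.
elim/last_ind: w => [|w l IH]; first by rewrite cats0.
rewrite -rcons_cat => t; apply: leq_trans (star_length_rcons t).
by apply: IH; move: t; rewrite -cats1; exact: tight_prefix.
Qed.

(** Among the optimal factorizations into star words, one of minimal total length
    is tight: cancelling a pair of letters leaves star words. *)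
Lemma tight_blocks g : exists ss,
  [/\ all star_word ss, size ss = sl g, pi (flatten ss) = g & tight (flatten ss)].
Proof.
have [ss [ssP ssn ssE]] := star_length_blocks g.
elim: {ss}(size (flatten ss)) {-2}ss (leqnn (size (flatten ss))) ssP ssn ssE
  => [|n IH] ss le ssP ssn ssE.
  exists ss; split=> // p a b q r E; move: le; rewrite E size_cat /=; lia.
have [|nt] := pselect (tight (flatten ss)); first by exists ss.
have [p [a [b [q [r [E qa]]]]]] : exists p a b q r,
    flatten ss = p ++ (a, b) :: q ++ (a, ~~ b) :: r /\ word_in (in_star a) q.
  apply: contrapT => H; apply: nt => p a b q r E; apply/negP => qa.
  by apply: H; exists p, a, b, q, r.
have [s1 [s1P s1n s1E]] := remove_letter ssP E; move: s1E; rewrite catA => s1E.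
have [s2 [s2P s2n s2E]] := remove_letter s1P s1E.
apply: (IH s2) => //.
- by move: le; rewrite s2E E !size_cat /= !size_cat /=; lia.
- by rewrite s2n s1n.
- by rewrite s2E -catA -ssE E cancel_pair.
Qed.

Lemma tight_rcons w a b : tight w ->
  (forall p q, w = p ++ (a, ~~ b) :: q -> ~~ word_in (in_star a) q) ->
  tight (rcons w (a, b)).
Proof.
move=> wt wa p c d q r; case/lastP: r => [|r l].
  rewrite cats1 -rcons_cons -rcons_cat => /rcons_inj[wE ca db]; subst c.
  by apply: (wa p); rewrite db negbK.
rewrite -!(rcons_cons, rcons_cat) => /rcons_inj[wE _]; exact: wt wE.
Qed.

Lemma tight_rcons_noncommuting w e c a b : tight (rcons w (e, c)) ->
  ~~ in_star e a -> tight (rcons (rcons w (e, c)) (a, b)).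
Proof.
move=> wt ea; apply: tight_rcons => // p q.
case/lastP: q => [|q l].
  by rewrite cats1 => /rcons_inj[_ ae]; rewrite -ae in_starxx in ea.
rewrite -rcons_cons -rcons_cat => /rcons_inj[_ <-].
by rewrite /word_in all_rcons /= in_star_sym (negPf ea).
Qed.

Lemma tight_rcons_same w a b : tight (rcons w (a, b)) ->
  tight (rcons (rcons w (a, b)) (a, b)).
Proof.
move=> wt; apply: tight_rcons => // p q.
case/lastP: q => [|q l].
  by rewrite cats1 => /rcons_inj[_]; case: (b).
rewrite -rcons_cons -rcons_cat => /rcons_inj[wE <-].
rewrite /word_in all_rcons negb_and; apply/orP; right.
apply: (wt p a (~~ b) q [::]).
by rewrite wE negbK cats1 -rcons_cons -rcons_cat.
Qed.

(** If both signs were blocked, w would contain a letter a and its inverse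
    that both commute to the end, and hence cancel each other. *)
Lemma tight_extend w a : tight w -> exists b, tight (rcons w (a, b)).
Proof.
move=> wt; apply: contrapT => /forallNP H.
have D b : exists p q, w = p ++ (a, ~~ b) :: q /\ word_in (in_star a) q.
  apply: contrapT => D; apply: (H b); apply: tight_rcons => // p q wE.
  by apply/negP => qa; apply: D; exists p, q.
have [p [q [wE qa]]] := D false; have [p' [q' [wE' q'a]]] := D true.
have ab : (a, ~~ false) != (a, ~~ true) by rewrite xpair_eqE eqxx.
move: (wE); rewrite {1}wE' => /esym /(cat_cons_cases ab)[[r [_ qE]]|[r [pE q'E]]].
  apply: (negP (wt p a true r q' _)); first by rewrite wE qE.
  by apply: word_in_sub qa => x; rewrite qE mem_cat => ->.
apply: (negP (wt p' a false r q _)); first by rewrite wE' q'E.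
by apply: word_in_sub q'a => x; rewrite q'E mem_cat => ->.
Qed.

Lemma tight_inv w : tight w -> tight (word_inv w).
Proof.
move=> /tight_minimal wm; apply: minimal_tight => u uw.
have size_inv (t : word V) : size (word_inv t) = size t by rewrite size_rev size_map.
rewrite size_inv -(size_inv u); apply: wm.
by rewrite raag_pi_inv uw raag_pi_inv invgK.
Qed.

Definition noncommuting : rel (V * bool) := fun k l => ~~ in_star k.1 l.1.

Lemma tight_cat_chain w k v : tight (rcons w k) -> path noncommuting k v ->
  tight (rcons w k ++ v).
Proof.
elim: v w k => [|l v IH] w k; first by rewrite cats0.
move=> wt /= /andP[kl lv]; rewrite -cat_rcons; apply: IH => //.
by case: k l wt kl {lv} => e c [a b]; exact: tight_rcons_noncommuting.
Qed.

Lemma tight_nil : tight [::].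
Proof. by case. Qed.

Lemma tight_letter l : tight [:: l].
Proof.
by case: l => a b; apply: (@tight_rcons [::]); [exact: tight_nil | case].
Qed.

Lemma tight_chain k v : path noncommuting k v -> tight (k :: v).
Proof. by apply: (@tight_cat_chain [::]); exact: tight_letter. Qed.

Lemma sorted_rcons_prefix (e : rel (V * bool)) w l :
  sorted e (rcons w l) -> sorted e w.
Proof. by rewrite -cats1 => /cat_sorted2[]. Qed.

Lemma tight_sorted v : sorted noncommuting v -> tight v.
Proof. by case: v => [|k v]; [move=> _; exact: tight_nil | exact: tight_chain]. Qed.

(** When no two consecutive letters commute, no shuffling is possible and the
    tight word representing the value is unique. *)
Lemma chain_unique v u : sorted noncommuting v -> tight u -> pi u = pi v -> u = v.
Proof.
elim/last_ind: v u => [|v [a b] IH] u vc ut uE.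
  by have := tight_minimal ut (esym uE); rewrite leqn0 => /nilP.
have vt := tight_sorted vc.
have [u1 [u2 [uE' u12 u2a]]] := exchange vt uE.
have u2s : word_in (in_star a) u2.
  apply: minimal_star_word u2a; apply: tight_minimal.
  by move: ut; rewrite uE' -cat_rcons; exact: tight_suffix.
have u12t : tight (u1 ++ u2).
  apply: minimal_tight => r; rewrite u12 => /(tight_minimal _).
  have v't := tight_sorted (sorted_rcons_prefix vc).
  move=> /(_ v't); have := tight_minimal ut (esym uE).
  by rewrite uE' !size_cat size_rcons /=; lia.
have uv := IH _ (sorted_rcons_prefix vc) u12t u12.
case/lastP: u2 => [|u2 l] in uE' u12 u2a u2s u12t uv *.
  by rewrite uE' -uv cats0 cats1.
move: vc; rewrite -uv -rcons_cat -!cats1 -catA => /cat_sorted2[_].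
rewrite /= andbT /noncommuting in_star_sym; move: u2s.
by rewrite /word_in all_rcons => /andP[-> _].
Qed.

(** By uniqueness an optimal factorization cuts the word v ++ v' itself. Its last
    block cannot contain v', so the other blocks spell an extension of v, whose
    star length is at least that of v. *)
Lemma star_length_chain v v' : sorted noncommuting (v ++ v') -> ~~ star_word v' ->
  v' != [::] -> sl (pi v) < sl (pi (v ++ v')).
Proof.
move=> vc v's v'0; have [ss [ssP <- ssE sst]] := tight_blocks (pi (v ++ v')).
have ssv := chain_unique vc sst ssE; move: ssv ssP.
case/lastP: ss {ssE sst} => [|ss t].
  by case: (v) v'0 => //; case: (v').
rewrite size_rcons ltnS flatten_rcons all_rcons => /cat_eq_cases H /andP[tP ssP].
case: H => [[r [_ tE]]|[r [ssE v'E]]].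
  case/negP: v's; apply: star_word_sub tP => x xv'; by rewrite tE mem_cat xv' orbT.
apply: leq_trans (star_length_flatten ssP); rewrite ssE.
apply/star_length_cat/tight_sorted; move: vc; rewrite v'E catA => /cat_sorted2[//].
Qed.

End StarLengthWords.

(** * Coarse trees *)

(** A sufficient condition, for a space with integer distances and a base point o,
    to be quasi-isometric to the tree of finite sequences of naturals. The
    vertices of level n of the model tree are the classes of conn_above (4 * n), the
    coarse components of the complement of a ball around o.

    The bottleneck hypothesis asks for a path s from x to y that every other
    coarse path from x to y has to follow up to distance 2; it makes the bottom of each
    component bounded (level_diameter). The branching hypothesis makes each
    component split into infinitely many in the next level. *)
Section CoarseTree.
Context (T : choiceType) (d : T -> T -> nat) (o : T).
Implicit Types (x y t : T) (z s : seq T) (n j : nat).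

Definition close x y : bool := d x y <= 1.

Let ht x := d o x.

Definition conn_above n x y : Prop := exists z,
  [/\ path close x z, last x z = y & all (fun t => n <= d o t) (x :: z)].

Hypothesis dxx : forall x, d x x = 0.
Hypothesis d_sym : forall x y, d x y = d y x.
Hypothesis d_triangle : forall y x t, d x t <= d x y + d y t.
Hypothesis d_geodesic : forall x y, exists z, [/\ path close x z, last x z = y &
  forall t, t \in x :: z -> d x t + d t y <= d x y].
Hypothesis d_bottleneck : forall x y, exists s, [/\ path close x s, last x s = y &
  forall z, path close x z -> last x z = y ->
  forall t, t \in x :: s -> exists2 t', t' \in x :: z & d t t' <= 2].
Hypothesis d_branching : forall x, exists y : nat -> T,
  [/\ forall i, ht x + 4 <= ht (y i),
      forall i, conn_above (ht x) x (y i) &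
      forall i j, i < j -> ~ conn_above (ht x + 4) (y i) (y j)].
Hypothesis T_countable : countable [set: T]%classic.

Lemma conn_above_refl n x : n <= ht x -> conn_above n x x.
Proof. by move=> nx; exists [::]; rewrite /= nx. Qed.

Lemma conn_above_sym n x y : conn_above n x y -> conn_above n y x.
Proof.
move=> [z [xz <- nz]]; exists (rev (belast x z)); split.
- by rewrite rev_path; apply: sub_path xz => a b; rewrite /close d_sym.
- by case: z {xz nz} => //= t z; rewrite rev_cons last_rcons.
- by rewrite -rev_rcons -lastI all_rev.
Qed.

Lemma conn_above_trans n x y t :
  conn_above n x y -> conn_above n y t -> conn_above n x t.
Proof.
move=> [z [xz <- nz]] [z' [xz' <- nz']]; exists (z ++ z'); split.
- by rewrite cat_path xz.
- by rewrite last_cat.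
- by rewrite -cat_cons all_cat nz; case/andP: nz'.
Qed.

Lemma conn_above_ge n x y : conn_above n x y -> n <= ht x /\ n <= ht y.
Proof.
move=> xy; have ge a b : conn_above n a b -> n <= ht a by move=> [z [_ _ /andP[]]].
by split; [exact: ge xy | exact: ge (conn_above_sym xy)].
Qed.

Lemma conn_above_le m n x y : m <= n -> conn_above n x y -> conn_above m x y.
Proof.
move=> mn [z [xz zy nz]]; exists z; split=> //.
by apply: sub_all nz => t; exact: leq_trans.
Qed.

Lemma conn_above_close n x y : n <= ht x -> n <= ht y -> close x y ->
  conn_above n x y.
Proof. by move=> nx ny xy; exists [:: y]; rewrite /= nx ny andbT; split. Qed.

Lemma conn_above0 x y : conn_above 0 x y.
Proof.
have [z [xz zy _]] := d_geodesic x y; exists z; split=> //.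
by apply/allP.
Qed.

Lemma ht_close x y : close x y -> ht x <= ht y + 1.
Proof.
by rewrite /close d_sym => xy; apply: leq_trans (d_triangle y _ _) _; rewrite leq_add2l.
Qed.

Lemma descend_path n x z : path close x z -> ht (last x z) <= n <= ht x ->
  exists2 x', x' \in x :: z & ht x' = n /\ conn_above n x x'.
Proof.
elim: z x => [|y z IH] x /=.
  move=> _ nx; exists x; rewrite ?mem_head //; split; first by lia.
  by apply: conn_above_refl; lia.
move=> /andP[xy yz] /andP[zn nx]; have := ht_close xy => hxy.
have [xn|nx'] := eqVneq (ht x) n.
  by exists x; rewrite ?mem_head //; split=> //; apply: conn_above_refl; lia.
have ny : n <= ht y by lia.
have [|x' x'z [x'n yx']] := IH y yz; first by rewrite zn.
exists x'; first by rewrite inE x'z orbT.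
by split=> //; apply: conn_above_trans yx'; apply: conn_above_close.
Qed.

Lemma descend n x : n <= ht x -> exists x',
  [/\ ht x' = n, conn_above n x x' & d x x' <= ht x - n].
Proof.
move=> nx; have [z [xz zo zd]] := d_geodesic x o.
have [|x' /zd x'd [x'n xx']] := @descend_path n x z xz.
  by rewrite zo /ht dxx.
exists x'; split=> //; move: x'd x'n; rewrite /ht !(d_sym o) => h1 h2.
by lia.
Qed.

(** A discrete intermediate value principle, for a path covered by P and Q. *)
Lemma path_meets (P Q : T -> Prop) x s : path close x s -> P x -> Q (last x s) ->
  (forall t, t \in x :: s -> P t \/ Q t) ->
  exists a b, [/\ P a, Q b & d a b <= 1].
Proof.
elim: s x => [|y s IH] x /=; first by move=> _ Px Qx _; exists x, x; rewrite dxx.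
move=> /andP[xy ys] Px Qs PQ.
have [|Py|Qy] := PQ y; first by rewrite !inE eqxx orbT.
  by apply: (IH y) => // t ts; apply: PQ; rewrite inE ts orbT.
by exists x, y.
Qed.

(** The bottleneck path s follows the path from x to y above level n, so it stays
    above level n - 2. It also follows the geodesics from x down to o and
    from o up to y, which above level n - 4 stay within 4 of x or of y. Hence each
    point of s is within 6 of x or of y, and both kinds occur next to each other. *)
Lemma level_diameter n x y : ht x = n -> ht y = n -> conn_above n x y ->
  d x y <= 13.
Proof.
move=> xn yn [z [xz zy /allP zn]].
have [s [xs sy sP]] := d_bottleneck x y.
have [p [xp po pP]] := d_geodesic x o; have [q [oq qy qP]] := d_geodesic o y.
pose P t := d x t <= 6; pose Q t := d t y <= 6.
have [| | |a [b [Pa Qb ab]]] := @path_meets P Q x s xs.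
- by rewrite /P dxx.
- by rewrite sy /Q dxx.
- move=> t ts; have [t1 t1z tt1] := sP z xz zy t ts.
  have [||t2 t2pq tt2] := sP (p ++ q) _ _ t ts.
  + by rewrite cat_path xp po.
  + by rewrite last_cat po.
  have := zn _ t1z; have := d_triangle t o t1; have := d_triangle t2 o t.
  rewrite (d_sym t2 t) => h1 h2 h3.
  move: t2pq; rewrite -cat_cons mem_cat => /orP[/pP|t2q].
    rewrite (d_sym t2 o) (d_sym x o) => h4; left.
    by have := d_triangle t2 x t; rewrite (d_sym t2 t) /P; move: xn; rewrite /ht; lia.
  have := qP t2; rewrite inE t2q orbT => /(_ isT) h4; right.
  by have := d_triangle t2 t y; rewrite /Q; move: yn; rewrite /ht; lia.
have := d_triangle a x y; have := d_triangle b a y.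
by move: Pa Qb; rewrite /P /Q; lia.
Qed.

Local Open Scope classical_set_scope.

(** Levels are four apart, the gain in height in the branching hypothesis. *)
Definition branch j x : set T := [set y | conn_above (4 * j) x y].

Definition subbranches j x : set (set T) :=
  branch j.+1 @` [set y | 4 * j.+1 <= d o y /\ conn_above (4 * j) x y].

Lemma branchP j x y : 4 * j <= ht x -> 4 * j <= ht y ->
  branch j x = branch j y <-> conn_above (4 * j) x y.
Proof.
move=> jx jy; split.
  move=> xy; have : branch j y y by exact: conn_above_refl.
  by rewrite -xy.
move=> xy; apply/seteqP; split=> t; apply: conn_above_trans => //.
exact: conn_above_sym.
Qed.

Lemma subbranchesE j x y : conn_above (4 * j) x y ->
  subbranches j x = subbranches j y.
Proof.
have sub a b : conn_above (4 * j) a b -> subbranches j a `<=` subbranches j b.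
  move=> /conn_above_sym ab _ [t [jt xt] <-]; exists t => //; split=> //.
  exact: conn_above_trans ab xt.
by move=> xy; apply/seteqP; split; apply: sub => //; exact: conn_above_sym.
Qed.

Lemma subbranches_infinite j x : 4 * j <= ht x ->
  (subbranches j x #= [set: nat])%card.
Proof.
move=> jx; apply: eq_card_nat.
  apply: (sub_countable (B := [set: T])) => //.
  apply: card_le_trans (card_image_le _ _) _.
  exact: subset_card_le.
have [x' [x'j xx' _]] := descend jx.
have [y [y4 yx' ysep]] := d_branching x'.
have jy i : 4 * j.+1 <= ht (y i) by have := y4 i; rewrite x'j; lia.
have y_inj : {in [set: nat] &, injective (fun i => branch j.+1 (y i))}.
  suff lt i k : i < k -> branch j.+1 (y i) <> branch j.+1 (y k).
    by move=> i k _ _ ik; case: (ltngtP i k) => // /lt; rewrite ik.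
  move=> ik /branchP; rewrite mulnS addnC -x'j => /(_ _ _).
  by move=> H; apply: (ysep i k ik); apply: H; exact: y4.
move=> /(sub_finite_set (A := (fun i => branch j.+1 (y i)) @` [set: nat])).
rewrite (eq_finite_set (inj_card_eq y_inj)) => H; apply: infinite_nat; apply: H.
move=> _ [i _ <-]; exists (y i) => //; split; first exact: jy.
by apply: conn_above_trans xx' _; rewrite -x'j.
Qed.

(** Numbering the subbranches of each branch, by an arbitrary bijection that depends
    only on this set of subbranches, turns a branch of level j into
    a sequence of j naturals, the most recent choice first. *)
Section Address.
Context (index : set (set T) -> set T -> nat).
Hypothesis index_bij : forall S : set (set T),
  (S #= [set: nat])%card -> set_bij S [set: nat] (index S).

Fixpoint address j x : seq nat :=
  if j is i.+1 then index (subbranches i x) (branch i.+1 x) :: address i x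
  else [::].

Lemma size_address j x : size (address j x) = j.
Proof. by elim: j => //= j ->. Qed.

Lemma addressP j x y : 4 * j <= ht x -> 4 * j <= ht y ->
  address j x = address j y <-> conn_above (4 * j) x y.
Proof.
elim: j x y => [|j IH] x y jx jy; first by split=> // _; exact: conn_above0.
have jx' : 4 * j <= ht x by lia.
have jy' : 4 * j <= ht y by lia.
split=> [/= [hd /(IH _ _ jx' jy') xy]|xy].
  apply/branchP => //; move: hd; rewrite -(subbranchesE xy).
  have [_ inj _] := index_bij (subbranches_infinite jx').
  apply: inj; apply/mem_set.
    by exists x => //; split=> //; exact: conn_above_refl.
  by exists y.
have xy' : conn_above (4 * j) x y by apply: conn_above_le xy; lia.
rewrite /= (subbranchesE xy'); congr (_ :: _); last by apply/IH.
by congr index; apply/branchP.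
Qed.

Lemma address_surj (s : seq nat) :
  exists2 x, 4 * size s <= ht x & address (size s) x = s.
Proof.
elim: s => [|n s [x sx xs]]; first by exists o.
have [_ _ surj] := index_bij (subbranches_infinite sx).
have [_ [y [sy xy] <-] yn] := surj n I.
exists y => //=; rewrite -(subbranchesE xy) yn; congr (_ :: _).
rewrite -[RHS]xs; apply/esym/addressP => //.
by case: (conn_above_ge xy).
Qed.

Lemma address_suffix i j x (s r : seq nat) : address j x = s ++ r -> size r = i ->
  address i x = r.
Proof.
elim: j s => [|j IH] [|n s] //=.
- by move=> <- <-.
- by move=> <- <-; rewrite -[address j x]/(behead (address j.+1 x)) /= size_address.
- by move=> [_ /IH]; apply.
Qed.

Definition tree_vertex x := address (ht x %/ 4) x.

Lemma level_le x : 4 * (ht x %/ 4) <= ht x.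
Proof. by rewrite mulnC leq_divM. Qed.

Lemma tree_vertex_close x y : close x y ->
  tree_vertex x = tree_vertex y \/ Tinf_edge (tree_vertex x) (tree_vertex y).
Proof.
wlog le : x y / ht x %/ 4 <= ht y %/ 4.
  move=> W xy; have [le|/ltnW le] := leqP (ht x %/ 4) (ht y %/ 4).
    exact: W.
  have [|->|] := W y x le; first by rewrite /close d_sym.
    by left.
  by rewrite Tinf_edge_sym; right.
move=> xy; have yx : close y x by rewrite /close d_sym.
have := ht_close xy; have := ht_close yx; have := level_le x; have := level_le y.
rewrite /tree_vertex; set i := ht x %/ 4 in le *; set j := ht y %/ 4 in le *.
move=> jy ix hyx hxy.
have E : address i x = address i y.
  by apply/addressP; [lia | lia | apply: conn_above_close => //; lia].
have [ij|ij] := eqVneq i j; first by left; rewrite E ij.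
have -> : j = i.+1 by lia.
by right; rewrite E /Tinf_edge /= eqxx.
Qed.

(** The common suffix r says that x and y belong to one branch of level size r, whose
    bottom is bounded by level_diameter; the remaining distance is the
    descent from x and from y to this bottom, four per level, plus at most four for
    the incomplete last level of each, whence 21 = 13 + 4 + 4. *)
Lemma tree_vertex_dist x y (s s' r : seq nat) :
  tree_vertex x = s ++ r -> tree_vertex y = s' ++ r ->
  d x y <= 4 * (size s + size s') + 21.
Proof.
rewrite /tree_vertex => xE yE.
have [sx sy] : ht x %/ 4 = size s + size r /\ ht y %/ 4 = size s' + size r.
  by rewrite -!size_cat -xE -yE !size_address.
have [lx ly] := (level_le x, level_le y).
have xy : conn_above (4 * size r) x y.
  apply/addressP; [lia | lia |].
  by rewrite (address_suffix xE) // (address_suffix yE).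
have [xr yr] := conn_above_ge xy.
have [x' [x'r xx' dx]] := descend xr; have [y' [y'r yy' dy]] := descend yr.
have x'y' : conn_above (4 * size r) x' y'.
  exact: conn_above_trans (conn_above_sym xx') (conn_above_trans xy yy').
have := level_diameter x'r y'r x'y'; have := d_triangle x' x y.
have := d_triangle y' x' y; rewrite (d_sym y' y).
have := divn_eq (ht x) 4; have := divn_eq (ht y) 4.
have := ltn_pmod (ht x) (isT : 0 < 4); have := ltn_pmod (ht y) (isT : 0 < 4).
by lia.
Qed.

Lemma tree_vertex_surj (s : seq nat) : exists x, tree_vertex x = s.
Proof.
have [x /descend[x' [x's xx' _]] xs] := address_surj s.
exists x'; rewrite /tree_vertex x's mulKn // -[RHS]xs.
by apply/addressP; [rewrite x's | case: (conn_above_ge xx') | exact: conn_above_sym].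
Qed.

End Address.

(** These properties make f a quasi-isometry. In the second one, when r is the longest
    common suffix, size s + size s' is the distance of f x and f y in the tree. *)
Theorem coarse_tree : exists f : T -> seq nat,
  [/\ forall x y, d x y <= 1 -> f x = f y \/ Tinf_edge (f x) (f y),
      forall x y (s s' r : seq nat), f x = s ++ r -> f y = s' ++ r ->
        d x y <= 4 * (size s + size s') + 21 &
      forall s : seq nat, exists x, f x = s].
Proof.
have /choice[index index_bij] : forall S : set (set T), exists f : set T -> nat,
    (S #= [set: nat])%card -> set_bij S [set: nat] f.
  move=> S; have [/card_set_bijP[f fS]|SN] := pselect (S #= [set: nat])%card.
    by exists f.
  by exists (fun=> 0).
exists (tree_vertex index); split.
- exact: tree_vertex_close.
- exact: tree_vertex_dist.
- exact: tree_vertex_surj.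
Qed.

End CoarseTree.

(** * Geometry of the star length metric *)

Section StarGeometry.
Context (V : finType) (G : sgraph V).
Local Notation A := (raag G).
Local Notation pi := (raag_pi G).
Local Notation sl := (@star_length V G).
Local Notation tight := (tight G).
Local Notation in_star := (in_star G).
Local Notation star_word := (star_word G).
Implicit Types (u w p q r : word V) (g h x y : A) (a e : V) (b : bool)
  (ss : seq (word V)) (z : seq A).

(** The left-invariant form of the star length metric; inversion exchanges the
    two, and a word then spells a path that starts at the left. *)
Definition ldist x y : nat := sl (x^-1 * y)%g.

Local Notation step := (close ldist).

Lemma ldistxx x : ldist x x = 0.
Proof. by rewrite /ldist mulVg star_length1. Qed.

Lemma ldist_sym x y : ldist x y = ldist y x.
Proof. by rewrite /ldist -star_lengthV invgM invgK. Qed.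

Lemma ldist_triangle y x (z : A) : ldist x z <= ldist x y + ldist y z.
Proof. by apply: leq_trans (star_lengthM _ _); rewrite mulgA mulgK. Qed.

Lemma ldist1 x : ldist 1%g x = sl x.
Proof. by rewrite /ldist invg1 mul1g. Qed.

Lemma ldistM x y h : ldist (h * x)%g (h * y)%g = ldist x y.
Proof. by rewrite /ldist invgM -mulgA mulKg. Qed.

Lemma ldist_mul x h : ldist x (x * h)%g = sl h.
Proof. by rewrite /ldist mulKg. Qed.

Lemma star_length_word w : star_word w -> sl (pi w) <= 1.
Proof.
move=> ws; have := @star_length_flatten _ G [:: w].
by rewrite /= cats0 ws; apply.
Qed.

Lemma star_length_elt a g : star_elt a g -> sl g <= 1.
Proof. by move=> [w wa <-]; apply: star_length_word; apply/existsP; exists a. Qed.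

Lemma star_length_letter (l : V * bool) : sl (pi [:: l]) <= 1.
Proof.
by case: l => a b; apply/(@star_length_elt a)/star_elt_letter/in_starxx.
Qed.

Definition trace (I : Type) (f : I -> A) x (s : seq I) : seq A :=
  scanl (fun h i => h * f i)%g x s.

Lemma last_trace (I : Type) (f : I -> A) x s :
  last x (trace f x s) = (x * \prod_(i <- s) f i)%g.
Proof.
elim: s x => [|i s IH] x /=; first by rewrite big_nil mulg1.
by rewrite big_cons IH mulgA.
Qed.

Lemma path_trace (I : Type) (f : I -> A) x s :
  all (fun i => sl (f i) <= 1) s -> path step x (trace f x s).
Proof.
elim: s x => [|i s IH] x //= /andP[fi /IH ->]; rewrite andbT.
by rewrite /close ldist_mul.
Qed.

Lemma mem_trace (I : Type) (f : I -> A) x s y :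
  y \in x :: trace f x s ->
  exists s1 s2, s = s1 ++ s2 /\ y = (x * \prod_(i <- s1) f i)%g.
Proof.
elim: s x => [|i s IH] x.
  by rewrite inE => /eqP ->; exists [::], [::]; rewrite big_nil mulg1.
rewrite inE => /orP[/eqP ->|/IH[s1 [s2 [-> ->]]]].
  by exists [::], (i :: s); rewrite big_nil mulg1.
by exists (i :: s1), s2; rewrite big_cons mulgA.
Qed.

Lemma prod_flatten ss : (\prod_(w <- ss) pi w)%g = pi (flatten ss).
Proof.
elim: ss => [|w ss IH]; first by rewrite big_nil.
by rewrite /= big_cons raag_pi_cat IH.
Qed.

Lemma prod_letters w : (\prod_(l <- w) pi [:: l])%g = pi w.
Proof.
elim: w => [|l w IH]; first by rewrite big_nil.
by rewrite big_cons IH -raag_pi_cat.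
Qed.

Lemma geodesic x y : exists z, [/\ path step x z, last x z = y,
  size z = ldist x y &
  forall t, t \in x :: z -> ldist x t + ldist t y <= ldist x y].
Proof.
have [ss [ssP ssn ssE]] := star_length_blocks (x^-1 * y)%g.
have yE : (x * \prod_(w <- ss) pi w)%g = y by rewrite prod_flatten ssE mulVKg.
exists (trace pi x ss); split.
- apply: path_trace; apply: sub_all ssP; exact: star_length_word.
- by rewrite last_trace.
- by rewrite size_scanl.
- move=> t /mem_trace[s1 [s2 [E ->]]]; rewrite ldist_mul.
  have {1}-> : y = (x * \prod_(w <- s1) pi w * \prod_(w <- s2) pi w)%g.
    by rewrite -mulgA -big_cat -E.
  rewrite ldist_mul /ldist -ssn E size_cat !prod_flatten.
  move: ssP; rewrite E all_cat => /andP[s1P s2P].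
  by apply: leq_add; exact: star_length_flatten.
Qed.

Lemma short_word g : sl g <= 1 -> exists w, pi w = g /\
  forall w1 w2, w = w1 ++ w2 -> sl (pi w1) <= 1.
Proof.
have [[|w [|w' ss]] [ssP ssn ssE]] := star_length_blocks g; rewrite -ssn //= => _.
  exists [::]; rewrite -ssE; split=> // -[] // w2 _.
  by rewrite raag_pi_nil star_length1.
exists w; split; first by rewrite -ssE /= cats0.
move=> w1 w2 wE; apply: star_length_word; move: ssP => /=; rewrite andbT.
by apply: star_word_sub => l l1; rewrite wE mem_cat l1.
Qed.

(** Each step of a path in the star metric is spelled inside one star, so spelling
    the whole path never leaves the neighbourhood of its vertices. *)
Lemma path_word x z : path step x z ->
  exists w, pi w = (x^-1 * last x z)%g /\
    forall w1 w2, w = w1 ++ w2 ->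
      exists2 t, t \in x :: z & ldist (x * pi w1)%g t <= 1.
Proof.
elim: z x => [|x' z IH] x /=.
  move=> _; exists [::]; rewrite mulVg; split=> // -[] // w2 _.
  by exists x; rewrite ?mem_head // raag_pi_nil mulg1 ldistxx.
move=> /andP[/short_word[w [wE wP]] /IH[w' [w'E w'P]]].
exists (w ++ w'); split; first by rewrite raag_pi_cat wE w'E -mulgA mulVKg.
move=> w1 w2 /cat_eq_cases[[r [-> w'r]]|[r [w1E _]]].
  have [t tz td] := w'P _ _ w'r.
  exists t; first by rewrite inE tz orbT.
  by rewrite raag_pi_cat wE mulgA mulVKg.
exists x; first exact: mem_head.
by rewrite ldist_sym ldist_mul; exact: wP w1E.
Qed.

(** Every path in the star metric with the same endpoints as the tight word p ++ q
    passes near the point reached by p: if a is the first letter of q, the word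
    that spells the path crosses the class of this letter, in a coset
    of the star subgroup of a, and such a coset has diameter at most one. *)
Lemma bottleneck x z p q : path step x z -> tight (p ++ q) ->
  pi (p ++ q) = (x^-1 * last x z)%g ->
  exists2 t, t \in x :: z & ldist (x * pi p)%g t <= 2.
Proof.
move=> xz pqt pqE; case: q => [|[a b] q] in pqt pqE.
  exists (last x z); first exact: mem_last.
  by move: pqE; rewrite cats0 => ->; rewrite mulVKg ldistxx.
have [w [wE wP]] := path_word xz.
have [w1 [w2 [w12 w1a]]] := crossing pqt (etrans wE (esym pqE)).
have [t tz td] := wP _ _ w12; exists t => //.
apply: leq_trans (ldist_triangle (x * pi w1)%g _ _) _.
by apply: (@leq_add _ _ 1 1 _ td); rewrite ldistM; exact: star_length_elt w1a.
Qed.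

Lemma bottleneck_path x y : exists s, [/\ path step x s, last x s = y &
  forall z, path step x z -> last x z = y ->
  forall t, t \in x :: s -> exists2 t', t' \in x :: z & ldist t t' <= 2].
Proof.
have [u /minimal_tight ut uE] := minimal_exists (x^-1 * y)%g.
exists (trace (fun l => pi [:: l]) x u); split.
- by apply: path_trace; apply/allP => l _; exact: star_length_letter.
- by rewrite last_trace prod_letters uE mulVKg.
- move=> z xz zy t /mem_trace[p [q [E ->]]]; rewrite prod_letters.
  by apply: (bottleneck (q := q) xz); rewrite -E // zy.
Qed.

(** A geodesic from 1 to the end passes within 2 of the point w; the loss of 2 is
    incurred on both sides of that point. *)
Lemma star_length_growth w v : tight (w ++ v) ->
  sl (pi w) + sl (pi v) <= sl (pi (w ++ v)) + 4.
Proof.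
move=> wvt; have [z [xz zE _ zP]] := geodesic 1%g (pi (w ++ v)).
have [|t tz] := bottleneck xz wvt; first by rewrite zE invg1 mul1g.
rewrite mul1g => wt; have := zP t tz; rewrite !ldist1.
have := ldist_triangle t 1%g (pi w); rewrite !ldist1 (ldist_sym t) => h1.
have := ldist_triangle t (pi w) (pi (w ++ v)).
by rewrite {1}raag_pi_cat ldist_mul; lia.
Qed.

Lemma conn_above_extend u w : tight (u ++ w) ->
  conn_above ldist 1%g (sl (pi u)) (pi u) (pi (u ++ w)).
Proof.
move=> uwt; exists (trace (fun l => pi [:: l]) (pi u) w); split.
- by apply: path_trace; apply/allP => l _; exact: star_length_letter.
- by rewrite last_trace prod_letters raag_pi_cat.
- apply/allP => t /mem_trace[p [q [wE ->]]]; rewrite prod_letters -raag_pi_cat ldist1.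
  by apply: star_length_cat; move: uwt; rewrite wE catA; exact: tight_prefix.
Qed.

Lemma tight_cat_nseq u l n : tight (rcons u l) -> tight (rcons u l ++ nseq n l).
Proof.
case: l => a b; elim: n u => [|n IH] u ut; first by rewrite cats0.
by rewrite /= -cat_rcons; apply/IH/tight_rcons_same.
Qed.

Lemma nseq_rcons (T : Type) n (l : T) : l :: nseq n l = rcons (nseq n l) l.
Proof. by elim: n => //= n ->. Qed.

Lemma tight_nseq_chain u l n v : tight (rcons u l) -> path (noncommuting G) l v ->
  tight (u ++ nseq n.+1 l ++ v).
Proof.
move=> ul lv; rewrite /= -cat_cons nseq_rcons catA -rcons_cat.
apply: tight_cat_chain lv; rewrite rcons_cat -nseq_rcons -cat_rcons.
exact: tight_cat_nseq.
Qed.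

(** With u a tight word for x and the sign of e chosen so that u e is tight, the
    points x e^n v, for n > 0, are above x by monotonicity, and high by
    star_length_growth. The tight word v^-1 e^k v leads from one of them to
    another; it passes through x e^n, which is within 1 of x, so by the
    bottleneck every path between them comes down near x. The bound 8 is the gain 4
    that is wanted plus the loss 4 in star_length_growth. *)
Lemma branching e x :
  (exists v, path (noncommuting G) (e, false) v /\ 8 <= sl (pi v)) ->
  exists y : nat -> A,
  [/\ forall i, sl x + 4 <= sl (y i),
      forall i, conn_above ldist 1%g (sl x) x (y i) &
      forall i j, i < j -> ~ conn_above ldist 1%g (sl x + 4) (y i) (y j)].
Proof.
move=> [v [ev v8]]; have [u /minimal_tight ut <-] := minimal_exists x.
have [b ub] := tight_extend e ut; set l := (e, b).
have lv : path (noncommuting G) l v by move: ev; case: (v).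
have yt n : tight (u ++ nseq n.+1 l ++ v) by exact: tight_nseq_chain.
exists (fun n => pi (u ++ nseq n.+1 l ++ v)); split.
- move=> i; have := yt i; rewrite catA => yti.
  have := star_length_growth yti; have := star_length_cat (tight_prefix yti).
  by lia.
- by move=> i; exact: conn_above_extend.
- move=> i j ij [z [yz zE /allP zP]].
  have mid : tight (word_inv v ++ nseq (j - i) l ++ v).
    have -> : j - i = (j - i.+1).+1 by lia.
    apply: tight_nseq_chain => //.
    have vt : tight v.
      by move: lv => /path_sorted/tight_sorted.
    move/tight_inv: vt lv; case: (v) => [_ _|[a c] v']; first exact: tight_letter.
    rewrite /word_inv /= rev_cons => vt /andP[la _].
    by apply: tight_rcons_noncommuting => //; rewrite in_star_sym.
  (* the bottleneck is taken at the end of v^-1, where the next letter is e *)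
  have [|t tz] := bottleneck yz mid.
    rewrite zE; have -> : j.+1 = i.+1 + (j - i) by lia.
    rewrite nseqD !raag_pi_cat raag_pi_inv !invgM !mulgA.
    by rewrite !mulgVK.
  rewrite catA raag_pi_cat raag_pi_inv mulgK => ty.
  have := zP t tz; have := ldist_triangle (pi (u ++ nseq i.+1 l)) 1%g t.
  have : sl (pi (nseq i.+1 l)) <= 1.
    apply: (@star_length_elt e); exists (nseq i.+1 l) => //.
    by rewrite /word_in all_nseq in_starxx orbT.
  have := star_lengthM (pi u) (pi (nseq i.+1 l)).
  by rewrite -raag_pi_cat !ldist1; lia.
Qed.

End StarGeometry.

(** * Joins and irreducible graphs *)

Section Dichotomy.
Context (V : finType) (G : sgraph V).
Local Notation A := (raag G).
Local Notation pi := (raag_pi G).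
Local Notation sl := (@star_length V G).
Local Notation in_star := (in_star G).
Local Notation star_word := (star_word G).
Implicit Types (w : word V) (g : A) (a e v : V) (s : seq V).

Definition opposite : rel V := fun a v => ~~ in_star a v.

Lemma raag_pi_split (P : pred V) w :
  (forall a v, P a -> ~~ P v -> in_star v a) ->
  pi w = (pi [seq l <- w | P l.1] * pi [seq l <- w | ~~ P l.1])%g.
Proof.
move=> join; elim: w => [|[v b] w IH]; first by rewrite raag_pi_nil mulg1.
rewrite -(cat1s (v, b)) raag_pi_cat IH /=; case: (boolP (P v)) => vP /=.
  by rewrite mulgA -(raag_pi_cat _ [:: (v, b)]).
rewrite mulgA (@star_word_commute _ _ v).
  by rewrite -mulgA -(raag_pi_cat _ [:: (v, b)]).
by apply/allP => -[a c]; rewrite mem_filter /= => /andP[aP _]; exact: join.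
Qed.

(** The component of a0 in the opposite graph and its complement are joined by all
    possible edges of the graph. So the group is the product of the two subgroups
    they generate, the first inside the star of v0, the second inside that
    of a0. *)
Lemma star_length_join a0 v0 : ~~ connect opposite a0 v0 -> forall g, sl g <= 2.
Proof.
move=> av g; have [w <-] := raag_pi_surj g.
have opp_sym : connect_sym opposite.
  by apply: sym_connect_sym => x y; rewrite /opposite in_star_sym.
have join a v : connect opposite a0 a -> ~~ connect opposite a0 v -> in_star v a.
  move=> aa; apply: contraR => va; apply: (connect_trans aa); apply: connect1.
  by rewrite /opposite in_star_sym.
rewrite (raag_pi_split _ join); apply: leq_trans (star_lengthM _ _) _.
apply: (@leq_add _ _ 1 1); apply: star_length_word; apply/existsP.
  exists v0; apply/allP => l; rewrite mem_filter => /andP[la _]; exact: join.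
exists a0; apply/allP => l; rewrite mem_filter => /andP[la _].
by rewrite in_star_sym; exact: join.
Qed.

Lemma star_length_small : #|V| <= 1 -> forall g, sl g <= 2.
Proof.
move=> V1 g; have [w <-] := raag_pi_surj g.
case: w => [|l w]; first by rewrite raag_pi_nil star_length1.
apply: (@leq_trans 1) => //; apply: star_length_word; apply/existsP; exists l.1.
apply/allP => k _; have -> : k.1 = l.1; last exact: in_starxx.
by apply: (card_le1_eqP V1).
Qed.

Section Irreducible.
Hypothesis opposite_connected : forall a v, connect opposite a v.
Hypothesis card_V : 1 < #|V|.

Lemma star_proper a : exists v, opposite a v.
Proof.
have [v] : exists v, v \in predC1 a.
  by apply/card_gt0P; rewrite cardC1; move: card_V; lia.
rewrite inE => va; have /connectP[[|x p] /= ap vE] := opposite_connected a v.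
  by rewrite vE eqxx in va.
by exists x; case/andP: ap.
Qed.

Lemma covering_walk e : exists s, path opposite e s /\ forall v, v \in s.
Proof.
have cover (t : seq V) a : exists s, path opposite a s /\ {subset t <= s}.
  elim: t a => [|v t IH] a; first by exists [::].
  have [x ax] := star_proper a.
  have /connectP[p xp vE] := opposite_connected x v.
  have [s [vs ts]] := IH v.
  exists ((x :: p) ++ s); rewrite cat_path /= ax xp -vE; split=> // y.
  rewrite inE -cat_cons mem_cat => /orP[/eqP ->|/ts ->]; last by rewrite orbT.
  by rewrite vE mem_last.
have [s [es sV]] := cover (enum V) e; exists s; split=> // v.
by apply: sV; rewrite mem_enum.
Qed.

(** Walks in the opposite graph spell chains of letters that do not commute with
    the next one, and a walk that visits every vertex is not inside a star, so
    that star_length_chain applies to a concatenation of such walks. *)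
Lemma long_chain e n :
  exists w, path (noncommuting G) (e, false) w /\ n <= sl (pi w).
Proof.
pose posw s : word V := [seq (v, false) | v <- s].
suff [s [es ns]] : exists s, path opposite e s /\ n <= sl (pi (posw s)).
  by exists (posw s); split=> //; rewrite path_map.
elim: n => [|n [s [es ns]]]; first by exists [::].
have [s' [es' s'V]] := covering_walk (last e s).
exists (s ++ s'); rewrite cat_path es es'; split=> //.
apply: (leq_ltn_trans ns); rewrite /posw map_cat; apply: star_length_chain.
- rewrite -map_cat sorted_map; apply: (@path_sorted _ _ e).
  by rewrite cat_path es.
- apply/negP => /existsP[a /allP aP]; have [v av] := star_proper a.
  by move: av; rewrite /opposite (aP (v, false)) // map_f.
- by have := s'V e; case: (s').
Qed.

End Irreducible.

End Dichotomy.

(** * Distances in the realization of a graph *)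

Section Interpolation.
Local Open Scope ring_scope.
Context (R : realType) (V : choiceType) (G : sgraph V) (f : V -> R).
Implicit Types (x y : realization R G).

(** The affine extension of f from the vertices to the realization. *)
Definition interpolate x : R := \sum_(v \in [set: V]%classic) x v * f v.

Lemma interpolate_face x a b : is_face G a b -> in_face a b x ->
  interpolate x = x a * (f a - f b) + f b.
Proof.
move=> ab [t _ xE]; rewrite /interpolate xE (@fsbigTE _ _ _ _ [fset a; b]%fset).
  have [<-|ne] := eqVneq a b.
    by rewrite fsetUid big_seq_fset1 /edge_pt eqxx !mulr1 subrK subrr mulr0 add0r mul1r.
  rewrite big_fsetU1 ?inE //= big_seq_fset1 /edge_pt !eqxx (negPf ne) eq_sym.
  by rewrite (negPf ne) !mulr0 !mulr1 addr0 add0r; ring.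
move=> v; rewrite !inE negb_or /edge_pt => /andP[/negPf -> /negPf ->].
by rewrite !mulr0 addr0 mul0r.
Qed.

Lemma interpolate_vertex v : interpolate (vertex_pt R G v) = f v.
Proof.
rewrite (@interpolate_face _ v v); [|by left|exact: vertex_in_face_l].
by rewrite subrr mulr0 add0r.
Qed.

Hypothesis f_edge : forall a b, G a b -> `|f a - f b| <= 1.

Lemma interpolate_lipschitz x y l : pl_path x y l ->
  `|interpolate x - interpolate y| <= l.
Proof.
elim=> {x y l} [x|x y z a b l ab xab yab _ IH]; first by rewrite subrr normr0.
apply: le_trans (ler_distD (interpolate y) _ _) _; apply: lerD IH.
rewrite !(interpolate_face ab) // opprD addrACA subrr addr0 -mulrBl normrM.
rewrite ler_piMr //; case: ab => [->|/f_edge //]; by rewrite subrr normr0 ler01.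
Qed.

(** A function on the vertices that changes by at most one along edges bounds
    the path metric from below. *)
Lemma length_dist_vertices u v : gconnected G ->
  `|f u - f v| <= length_dist (vertex_pt R G u) (vertex_pt R G v).
Proof.
move=> Gc; apply: length_dist_ge => // l /interpolate_lipschitz.
by rewrite !interpolate_vertex.
Qed.

End Interpolation.

Lemma Tinf_edgeP a b : Tinf_edge a b -> exists n, b = n :: a \/ a = n :: b.
Proof.
case/orP => /andP[]; [case: b => // n b | case: a => // n a]; move=> _ /eqP <-.
  by exists n; left.
by exists n; right.
Qed.

Section TreeDistance.
Implicit Types (r s t : seq nat).

(** The distance from s to t in the tree of finite sequences, in which parents are
    tails: the recursion climbs from t to its first ancestor that is a suffix of s,
    from which s is reached by descending. *)
Fixpoint tree_dist s t : nat :=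
  if t is n :: t' then
    if suffix t s then size s - size t else (tree_dist s t').+1
  else size s.

Lemma tree_dist_suffix s t : suffix t s -> tree_dist s t = size s - size t.
Proof. by case: t => [|n t] /=; [rewrite subn0 | move=> ->]. Qed.

Lemma tree_dist_cons s n t :
  tree_dist s t <= tree_dist s (n :: t) + 1 /\
  tree_dist s (n :: t) <= tree_dist s t + 1.
Proof.
rewrite /=; case: ifP => [nts|_]; last by lia.
have ts : suffix t s by apply: suffix_trans nts; exact: (suffix_suffix [:: n]).
have := size_suffix nts; rewrite (tree_dist_suffix ts) /=; lia.
Qed.

Lemma tree_dist_common_suffix s t : exists s1 t1 r,
  [/\ s = s1 ++ r, t = t1 ++ r & tree_dist s t = size s1 + size t1].
Proof.
elim: t => [|n t [s1 [t1 [r [sE tE IH]]]]].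
  by exists s, [::], [::]; rewrite !cats0 addn0.
rewrite /=; case: ifP => [/suffixP[s2 ->]|_].
  by exists s2, [::], (n :: t); rewrite size_cat addnK addn0.
by exists s1, (n :: t1), r; rewrite IH -addnS {1}sE {1}tE.
Qed.

Context (R : realType).

Lemma tree_dist_le s t : ((tree_dist s t)%:R <=
  length_dist (vertex_pt R Tinf_graph s) (vertex_pt R Tinf_graph t))%R.
Proof.
have edge a b : Tinf_graph a b ->
    (`|(tree_dist s a)%:R - (tree_dist s b)%:R : R| <= 1)%R.
  have up n c : (`|(tree_dist s (n :: c))%:R - (tree_dist s c)%:R : R| <= 1)%R.
    have [] := tree_dist_cons s n c; rewrite -!(ler_nat R) !natrD => h1 h2.
    by rewrite ler_distl lerBlDr h1 h2.
  by move=> /Tinf_edgeP[n [->|->]]; [rewrite distrC|]; exact: up.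
have := length_dist_vertices edge s t Tinf_connected.
rewrite (tree_dist_suffix (suffix_refl s)) subnn sub0r normrN.
by rewrite ger0_norm.
Qed.

End TreeDistance.

Lemma length_dist_edge (R : realType) (V : eqType) (G : sgraph V) (a b : V) :
  is_face G a b ->
  (length_dist (vertex_pt R G a) (vertex_pt R G b) <= 1)%R.
Proof.
move=> ab; apply: le_trans (length_dist_le (pl_path_step ab
  (vertex_in_face_l _ _ a b) (vertex_in_face_r _ _ a b))) _.
rewrite /= /edge_pt eqxx; case: (a == b) => /=; rewrite ler_distl;
  apply/andP; split; lra.
Qed.

Lemma near_vertex (R : realType) (V : eqType) (G : sgraph V) (x : realization R G) :
  exists a, (length_dist (vertex_pt R G a) x <= 1)%R.
Proof.
have [a [b [ab xab]]] := coordP x; exists a.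
apply: le_trans (length_dist_le (pl_path_step ab (vertex_in_face_l _ _ a b) xab)) _.
case: xab => t /andP[t0 t1] ->.
rewrite /= /edge_pt eqxx; case: (a == b) => /=; rewrite ler_distl;
  apply/andP; split; lra.
Qed.

(** * Quasi-isometries and the dichotomy *)

Section QuasiIsometry.
Local Open Scope ring_scope.
Context (R : realType).
Implicit Types X Y : metricType R.

Definition bounded X : Prop := exists B : R, forall x x' : X, mdist x x' <= B.

Lemma quasi_isometric_bounded X Y : quasi_isometric X Y -> bounded X <-> bounded Y.
Proof.
move=> [f [L [C [L1 C0 fL fC]]]]; have L0 : 0 < L by apply: lt_le_trans L1.
split=> -[B XB].
  exists (C + (L * B + C) + C) => y y'.
  have [[x xy] [x' x'y']] := (fC y, fC y').
  apply: le_trans (metric_triangle _ (f x') _) _; apply: lerD => //.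
  apply: le_trans (metric_triangle _ (f x) _) _; apply: lerD.
    by rewrite metric_sym.
  have /andP[_ /le_trans] := fL x x'; apply.
  by rewrite lerD2r ler_pM2l.
exists (L * (B + C)) => x x'.
have /andP[h _] := fL x x'.
rewrite mulrC -ler_pdivrMr // mulrC -lerBlDr; exact: le_trans h (XB _ _).
Qed.

Lemma bounded_quasi_isometric_point X : bounded X -> X ->
  quasi_isometric X (point_space R).
Proof.
move=> [B XB] x0; have B0 : 0 <= B by apply: le_trans (XB x0 x0); exact: mdist_ge0.
exists (fun=> tt : point_space R), 1, B; split=> //.
move=> x x'; rewrite [mdist (tt : point_space R) _]/(0 : R) invr1 !mul1r subr_le0 XB /=.
by rewrite addr_ge0 // mdist_ge0.
Qed.

Lemma point_bounded : bounded (point_space R).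
Proof. by exists 0. Qed.

Lemma Tinf_unbounded : ~ bounded (Tinf R).
Proof.
move=> [B XB]; have [n Bn] : exists n : nat, B < n%:R.
  by exists (Num.bound `|B|); apply: le_lt_trans (ler_norm B) _; exact: archi_boundP.
have := XB (vertex_pt R Tinf_graph (nseq n 0%N)) (vertex_pt R Tinf_graph [::]).
apply/negP; rewrite -ltNge; apply: lt_le_trans Bn _.
by apply: le_trans (tree_dist_le R _ _); rewrite /= size_nseq.
Qed.

End QuasiIsometry.

Lemma raag_countable (V : finType) (G : sgraph V) : countable [set: raag G]%classic.
Proof.
have -> : [set: raag G]%classic = (raag_pi G @` [set: word V])%classic.
  apply/seteqP; split=> // x _; exists (raag_repr x) => //; exact: raag_reprK.
apply: card_le_trans (card_image_le _ _) _; exact: (@countableP (seq (V * bool))).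
Qed.

Section Irreducible.
Context (R : realType) (V : finType) (G : sgraph V).
Local Notation A := (raag G).
Hypothesis opposite_connected : forall a v, connect (opposite G) a v.
Hypothesis card_V : 1 < #|V|.

Lemma star_coarse_tree : exists f : A -> seq nat,
  [/\ forall x y, close (@ldist V G) x y -> f x = f y \/ Tinf_edge (f x) (f y),
      forall x y (s s' r : seq nat), f x = s ++ r -> f y = s' ++ r ->
        ldist x y <= 4 * (size s + size s') + 21 &
      forall s : seq nat, exists x, f x = s].
Proof.
apply: (@coarse_tree A (@ldist V G) 1%g).
- exact: ldistxx.
- exact: ldist_sym.
- exact: ldist_triangle.
- by move=> x y; have [z [xz zy _ zd]] := geodesic x y; exists z.
- exact: bottleneck_path.
- move=> x; have [e _] : exists e : V, e \in V.
    by apply/card_gt0P; exact: ltnW card_V.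
  have [y [y4 xy ysep]] := branching x (long_chain opposite_connected card_V e 8).
  exists y; rewrite ldist1; split=> // i; first by rewrite ldist1.
- exact: raag_countable.
Qed.

Local Open Scope ring_scope.

(** The coarse tree is built for the left-invariant metric, hence the inverse. *)
Lemma star_space_quasi_isometric_Tinf :
  quasi_isometric (star_space R G) (Tinf R).
Proof.
have [f [f_near f_dist f_surj]] := star_coarse_tree.
pose F (x : A) : Tinf R := vertex_pt R Tinf_graph (f x^-1%g).
have F_near x y : close (@ldist V G) x y ->
    length_dist (vertex_pt R Tinf_graph (f x)) (vertex_pt R Tinf_graph (f y)) <= 1.
  by move=> /f_near xy; apply: length_dist_edge; case: xy; [left | right].
have dE (x y : star_space R G) : mdist x y = (@ldist V G x^-1%g y^-1%g)%:R.
  by rewrite /ldist invgK.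
have upper (x y : star_space R G) : mdist (F x) (F y) <= mdist x y.
  rewrite dE /F; have [z [xz <- <- _]] := geodesic (x^-1 : A)%g (y^-1)%g.
  elim: z (x^-1)%g xz => [|t z IH] u; first by rewrite mdistxx.
  move=> /= /andP[ut tz].
  apply: le_trans (metric_triangle _ (vertex_pt R Tinf_graph (f t) : Tinf R) _) _.
  by rewrite -add1n natrD; apply: lerD; [exact: F_near | exact: IH].
have lower (x y : star_space R G) : mdist x y <= 4 * mdist (F x) (F y) + 21.
  have [s [s' [r [sE s'E d]]]] := tree_dist_common_suffix (f x^-1%g) (f y^-1%g).
  rewrite dE.
  have := f_dist _ _ _ _ _ sE s'E; rewrite -d -(ler_nat R) natrD natrM.
  move=> h; apply: le_trans h _; rewrite lerD2r ler_pM2l //.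
  exact: tree_dist_le.
exists F, 4, 21; split=> //.
- by rewrite ler1n.
- move=> x y; apply/andP; split.
    have := lower x y; have := mdist_ge0 x y; have := mdist_ge0 (F x) (F y).
    set m := mdist (F x) _; set n := mdist x y => ? ? ?; lra.
  have := upper x y; have := mdist_ge0 x y.
  set m := mdist (F x) _; set n := mdist x y => ? ?; lra.
- move=> y; have [a ay] := near_vertex (y : realization R Tinf_graph).
  have [x xa] := f_surj a; exists (x^-1 : A)%g.
  rewrite /F invgK xa; apply: (@le_trans _ _ 1); first exact: ay.
  by rewrite ler1n.
Qed.

End Irreducible.

Lemma star_space_bounded (R : realType) (V : finType) (G : sgraph V) :
  (forall g : raag G, star_length g <= 2) -> bounded (star_space R G).
Proof. by move=> b; exists 2%:R%R => x y; rewrite ler_nat. Qed.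

Theorem theorem23 (R : realType) (V : finType) (G : sgraph V)
    (G_conn : gconnected G) :
  (quasi_isometric (star_space R G) (point_space R) /\
   ~ quasi_isometric (star_space R G) (Tinf R)) \/
  (quasi_isometric (star_space R G) (Tinf R) /\
   ~ quasi_isometric (star_space R G) (point_space R)).
Proof.
have [[opp V1]|red] := pselect ((forall a v, connect (opposite G) a v) /\ 1 < #|V|).
  right; have qi := star_space_quasi_isometric_Tinf R opp V1; split=> //.
  move=> pt; apply: (@Tinf_unbounded R); apply/(quasi_isometric_bounded qi).
  by apply/(quasi_isometric_bounded pt); exact: point_bounded.
left; have XB : bounded (star_space R G).
  apply: star_space_bounded; have [/star_length_small //|V1] := leqP #|V| 1.
  have [a [v]] : exists a v, ~~ connect (opposite G) a v.
    apply: contrapT => H; apply: red; split=> // a v.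
    by apply: contrapT => /negP av; apply: H; exists a, v.
  exact: star_length_join.
split; first exact: bounded_quasi_isometric_point XB (1%g : raag G).
by move=> /quasi_isometric_bounded[+ _] => /(_ XB); exact: Tinf_unbounded.
Qed.
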